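(* Let $n\ge1$, let $k_1,\dots,k_n\in\mathbb{Z}$ and let $l_1,\dots,l_n\ge1$ be integers, and let $$L=\llbracket k_1,k_1+l_1-1\rrbracket\times\cdots\times\llbracket k_n,k_n+l_n-1\rrbracket\subset\mathbb{Z}^n .$$ Then for every $k\in\mathbb{Z}$, $$\#\left\{z\in L:\sum_{i=1}^n z_i=k\right\}<\sqrt2\,\frac{\prod_{i=1}^n l_i}{\sqrt{\sum_{j=1}^n(l_j^2-1)}} .$$
   Context: $\llbracket a,b\rrbracket$ denotes the set of integers $m$ with $a\le m\le b$, and $\#$ denotes cardinality. If all $l_j=1$ the right-hand side is interpreted as $+\infty$. *)

(* Defs.v *)
From HB Require Import structures.
From mathcomp Require Import all_boot all_order all_algebra.
From mathcomp Require Import all_classical all_reals all_analysis.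

Set Implicit Arguments.
Unset Strict Implicit.
Unset Printing Implicit Defensive.

Import Order.TTheory GRing.Theory Num.Theory.

Local Open Scope classical_set_scope.
Local Open Scope ring_scope.

Definition box (n : nat) (k l : 'I_n -> int) : set {ffun 'I_n -> int} :=
  [set z | forall i, z i \in `[k i, k i + l i - 1]].

(* Main.v *)
(** A discrete version of Ball's cube slicing argument. Averaging over the
    angles x_r = pi r / N with N large, the number of solutions is at most the
    average of prod_i |D_(l_i)(x_r)|, where |D_l(x)| = |sin (l x) / sin x|.
    Put s_i = l_i^2 - 1, S = sum_i s_i and u_i = |D_(l_i) / l_i|^2. Weighted
    AM-GM gives prod_i sqrt u_i <= sum_i (s_i / S) u_i^(P_i) with
    P_i = S / (2 s_i), so it suffices to have
    avg (u^P) < (P (l^2 - 1))^(-1/2) for l >= 2 and P >= 1.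
    For l = 2, u = cos^2 x and this is a Wallis estimate. For l >= 3 and
    1 <= P <= 3 it follows from the exact averages of u, u^2 and u^3. For
    P >= 3 one uses u <= (cos^2 x)^((l^2 - 1) / 3) on the main lobe
    0 <= x <= pi / l, and |l sin x| >= 3 sin (pi / 3) outside of it. *)

Require Import Defs.
From HB Require Import structures.
From mathcomp Require Import all_boot all_order all_algebra.
From mathcomp Require Import all_classical all_reals all_analysis.
From mathcomp Require Import finmap complex ring lra zify.

Set Implicit Arguments.
Unset Strict Implicit.
Unset Printing Implicit Defensive.

Import Order.TTheory GRing.Theory Num.Theory.
Import numFieldNormedType.Exports.

Local Open Scope classical_set_scope.
Local Open Scope ring_scope.

(** * Inequalities for the exponential and real powers *)

(** After division by prod_i l_i the target is (S / 2)^(-1/2). The exponents satisfy P_i s_i = S / 2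
    for every i, so each factor has this same bound, and the weights, of sum 1, return it unchanged.
    P_i >= 1 means s_i <= S / 2; a dominant coordinate violates this and is treated apart. The grid
    replaces an integral: a trigonometric polynomial of low degree has its constant term as average,
    so all integer moments are exact finite sums. The tight point is P = 1: there the two sides 1 /
    l and (l^2 - 1)^(-1/2) have ratio tending to 1 as l grows, so exponents just above 1 need a
    bound with the right slope and not a mere interpolation of moments. For large P the main lobe
    has a Gaussian shape, and powers of cos^2 serve as a model of it because their integer moments
    are known. *)

Lemma nondecreasing_derive (R : realType) (f df : R -> R) (a b : R) :
  (forall x : R, is_derive x 1 f (df x)) -> a <= b ->
  (forall c, a <= c <= b -> 0 <= df c) -> f a <= f b.
Proof.
move=> fdf ab df0.
have cf : {within `[a, b], continuous f}.
  apply: derivable_within_continuous => x _.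
  by have [] := fdf x.
have [c cab e] := MVT_segment ab (fun x _ => fdf x) cf.
by rewrite -subr_ge0 e mulr_ge0 ?subr_ge0// df0// -(itvP cab).
Qed.

Lemma expR_ge_taylor (R : realType) (x : R) n : 0 <= x ->
  \sum_(0 <= k < n) x ^+ k / k`!%:R <= expR x.
Proof.
move=> x0; rewrite /expR.
have -> : \sum_(0 <= k < n) x ^+ k / k`!%:R = series (exp_coeff x) n by [].
apply: nondecreasing_cvgn_le; last exact: is_cvg_series_exp_coeff.
apply/nondecreasing_seqP => k; rewrite /series/= big_nat_recr//= lerDl.
exact: exp_coeff_ge0.
Qed.

Lemma expR_ge_taylor4 (R : realType) (x : R) : 0 <= x ->
  1 + x + x ^+ 2 / 2 + x ^+ 3 / 6 + x ^+ 4 / 24 <= expR x.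
Proof.
move=> /(expR_ge_taylor 5).
by rewrite !big_nat_recr//= big_geq// add0r !expr0 expr1 divr1 !divr1.
Qed.

Lemma expR1_ge (R : realType) : 27 / 10 <= expR 1 :> R.
Proof. have := @expR_ge_taylor4 R 1 ler01; rewrite !expr1n; lra. Qed.

(** This is the [1/1] Pade approximant of e^(-x); it yields an upper bound of e. *)
Lemma expRN_ge_pade (R : realType) (x : R) : 0 <= x ->
  2 - x <= (2 + x) * expR (- x).
Proof.
move=> x0; pose f (x : R) := (2 + x) * expR (- x) - (2 - x).
pose df (x : R) := 1 - (1 + x) * expR (- x).
have fdf (y : R) : is_derive y 1 f (df y).
  by apply: is_derive_eq; rewrite /df /GRing.scale/=; ring.
have := nondecreasing_derive fdf x0; rewrite /f oppr0 expR0 => H.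
rewrite -subr_ge0; apply: le_trans (H _); first by lra.
move=> c _; rewrite subr_ge0 expRN ler_pdivrMr ?expR_gt0// mul1r.
exact: expR_ge1Dx.
Qed.

Lemma expR1_le (R : realType) : expR 1 <= 11 / 4 :> R.
Proof.
(* The approximant is sharp only near 0, so it is taken at 1/4 and raised to the fourth power. *)
have h1 : 7 / 9 <= expR (- 4^-1) :> R.
  have : 2 - 4^-1 <= (2 + 4^-1) * expR (- 4^-1) :> R by apply: expRN_ge_pade; lra.
  lra.
have h2 : 35 / 58 <= expR (- 4^-1) * expR (- 4^-1) :> R by nra.
have e1 : expR 1 * ((expR (- 4^-1) * expR (- 4^-1)) *
                    (expR (- 4^-1) * expR (- 4^-1))) = 1 :> R.
  by rewrite -!expRD (_ : 1 + _ = 0) ?expR0//; field.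
have := expR_gt0 (1 : R).
move: (expR 1) (expR (- 4^-1) * _) h2 e1 => e a h2 e1 e0.
have : 35 / 58 * (35 / 58) <= a * a by apply: ler_pM => //; lra.
move=> /(ler_wpM2l (ltW e0)); rewrite e1; lra.
Qed.

(** Convexity of exp on the segment from 0 to w: the tangent at q w lies below the graph at both
    endpoints ([h1] and [h2], divided by e^(q w)). *)
Lemma expR_chord (R : realType) (q w : R) : 0 <= q <= 1 ->
  expR (q * w) <= 1 - q + q * expR w.
Proof.
move=> /andP[q0 q1].
have h1 := expR_ge1Dx ((1 - q) * w); have h2 := expR_ge1Dx (- q * w).
have -> : expR w = expR (q * w) * expR ((1 - q) * w).
  by rewrite -expRD; congr expR; ring.
have e1 : expR (q * w) * expR (- q * w) = 1.
  by rewrite -expRD mulNr subrr expR0.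
move: (expR_gt0 (q * w)) e1; set E := expR (q * w) => E0 e1.
set a := expR (- q * w) in h2 e1; set b := expR ((1 - q) * w) in h1 *.
have h3 : E * (1 - q * w) <= 1 by rewrite -e1 ler_pM2l//; lra.
have h4 : E * (1 + (1 - q) * w) <= E * b by rewrite ler_pM2l.
nra.
Qed.

(** Integrating [expR_chord] in w over [0, 1] gains the term in q (1 - q), which a quadratic
    correction of the chord needs at w = 1. *)
Lemma expR_chord1 (R : realType) (q : R) : 0 <= q <= 1 ->
  expR q <= 1 + q * (expR 1 - 1) - q * (1 - q) * (expR 1 - 2).
Proof.
move=> q01; have /andP[q0 q1] := q01.
pose f (x : R) :=
  1 + q * (expR x - 1) - q * (1 - q) * (expR x - 1 - x) - expR (q * x).
pose df (x : R) := q * (1 - q + q * expR x - expR (q * x)).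
have fdf (x : R) : is_derive x 1 f (df x).
  by apply: is_derive_eq; rewrite /df /GRing.scale/=; ring.
have := nondecreasing_derive fdf ler01.
rewrite /f mulr0 !expR0 mulr1 => H.
suff : 0 <= 1 + q * (expR 1 - 1) - q * (1 - q) * (expR 1 - 1 - 1) - expR q.
  lra.
apply: le_trans (H _); first by lra.
by move=> c _; rewrite mulr_ge0// subr_ge0 expR_chord.
Qed.

(* e^(-q w) times the right-hand side is nonincreasing on w <= 0 and first
   nondecreasing, then nonincreasing on [0, 1]: only its values at 0 and 1
   matter, and the constant 6/25 is what the value at 1 allows *)
Lemma expR_le_quadratic (R : realType) (q w : R) : 0 <= q <= 1 -> w <= 1 ->
  expR (q * w) <= 1 + q * (expR w - 1)
                  - 6 / 25 * (q * (1 - q)) * (expR w - 1) ^+ 2.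
Proof.
move=> q01 w1; have /andP[q0 q1] := q01.
pose k : R := 6 / 25 * (q * (1 - q)).
pose B (z : R) := 1 + q * (z - 1) - k * (z - 1) ^+ 2.
pose f (x : R) := expR (- q * x) * B (expR x).
pose br (x : R) := 1 - 12 / 25 - (2 - q) * (6 / 25) * (expR x - 1).
pose df (x : R) := expR (- q * x) * (q * (1 - q)) * (expR x - 1) * br x.
have fdf (x : R) : is_derive x 1 f (df x).
  rewrite /f /B; apply: is_derive_eq; rewrite /df /br /k /GRing.scale/=.
  ring.
have fNdf (x : R) : is_derive x 1 (- f) (- df x) by exact: is_deriveN.
have q1q : 0 <= q * (1 - q) by rewrite mulr_ge0// subr_ge0.
have E0 x : 0 <= expR (- q * x) * (q * (1 - q)) by rewrite mulr_ge0// expR_ge0.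
have brle x y : x <= y -> br y <= br x.
  by rewrite -ler_expR /br => xy; nra.
have f0 : f 0 = 1 by rewrite /f mulr0 expR0 /B; ring.
have f1 : 1 <= f 1.
  rewrite /f mulr1 expRN mulrC ler_pdivlMr ?expR_gt0// mul1r.
  apply: le_trans (expR_chord1 q01) _; rewrite /B /k.
  have := expR1_ge R; have := expR1_le R; set e := expR 1 => e1 e2.
  have : 6 / 25 * (e - 1) ^+ 2 <= e - 2 by nra.
  nra.
suff fw : 1 <= f w.
  move: fw; rewrite /f mulNr expRN mulrC ler_pdivlMr ?expR_gt0// mul1r.
  by move/le_trans; apply; rewrite /B /k; lra.
have [w0|w0] := lerP w 0.
  rewrite -f0; have := nondecreasing_derive fNdf w0; rewrite lerN2; apply.
  move=> c /andP[wc c0]; rewrite oppr_ge0 /df mulr_le0_ge0//.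
    by rewrite mulr_ge0_le0// subr_le0 -(expR0 R) ler_expR.
  apply: le_trans (brle _ _ c0); rewrite /br expR0; lra.
have [bw|bw] := lerP 0 (br w).
  rewrite -f0; apply: (nondecreasing_derive fdf (ltW w0)).
  move=> c /andP[c0 cw]; rewrite /df mulr_ge0//.
    by rewrite mulr_ge0// subr_ge0 -(expR0 R) ler_expR.
  exact: le_trans (brle _ _ cw).
apply: le_trans f1 _.
have := nondecreasing_derive fNdf w1; rewrite lerN2; apply.
move=> c /andP[wc c1]; rewrite oppr_ge0 /df mulr_ge0_le0//.
  rewrite mulr_ge0// subr_ge0 -(expR0 R) ler_expR.
  exact: le_trans (ltW w0) wc.
exact: le_trans (brle _ _ wc) (ltW bw).
Qed.

Lemma powR_bernoulli (R : realType) (t u : R) : 0 <= t <= 1 -> 0 <= u ->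
  u `^ t <= 1 - t + t * u.
Proof.
move=> t01; rewrite le_eqVlt => /predU1P[<-|u0].
  have [->|t0] := eqVneq t 0; first by rewrite powRr0; lra.
  by rewrite powR0//; lra.
by rewrite /powR gt_eqF// -[in leRHS](lnK u0); exact: expR_chord.
Qed.

(* The point 1/e makes the factor u0^q of the tangent at u0 equal to e^(-q) *)
Lemma powR_le_quadratic (R : realType) (q u : R) : 0 <= q <= 1 -> 0 <= u <= 1 ->
  u `^ q <= expR (- q) * (1 + q * (expR 1 * u - 1)
                  - 6 / 25 * (q * (1 - q)) * (expR 1 * u - 1) ^+ 2).
Proof.
move=> q01 /andP[]; have /andP[q0 q1] := q01.
rewrite le_eqVlt => /predU1P[<- _|u0 u1].
  have [->|qn0] := eqVneq q 0.
    by rewrite powRr0 oppr0 expR0; lra.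
  by rewrite powR0// mulr_ge0 ?expR_ge0//; nra.
have := @expR_le_quadratic _ q (1 + ln u) q01 _.
rewrite gerDl ln_le0// => /(_ isT).
rewrite expRD lnK// mulrDr mulr1 expRD => H.
rewrite /powR gt_eqF// expRN [leRHS]mulrC ler_pdivlMr ?expR_gt0//.
by rewrite mulrC.
Qed.

(** * Averages and exponents between 1 and 3 *)

Definition avg (R : realType) (N : nat) (F : 'I_N -> R) : R :=
  (\sum_(r < N) F r) / N%:R.

Section avg_theory.
Context (R : realType) (N : nat).
Implicit Types F G : 'I_N -> R.

Lemma eq_avg F G : F =1 G -> avg F = avg G.
Proof. by move=> FG; rewrite /avg (eq_bigr _ (fun i _ => FG i)). Qed.

Lemma avgD F G : avg (fun r => F r + G r) = avg F + avg G.
Proof. by rewrite /avg big_split mulrDl. Qed.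

Lemma avgZ (a : R) F : avg (fun r => a * F r) = a * avg F.
Proof. by rewrite /avg -mulr_sumr mulrA. Qed.

Lemma avgB F G : avg (fun r => F r - G r) = avg F - avg G.
Proof. by rewrite /avg sumrB mulrBl. Qed.

Lemma avg_sum (I : Type) (s : seq I) (P : pred I) (F : I -> 'I_N -> R) :
  avg (fun r => \sum_(i <- s | P i) F i r) = \sum_(i <- s | P i) avg (F i).
Proof. by rewrite /avg exchange_big/= mulr_suml. Qed.

Lemma avg_cst (a : R) : (0 < N)%N -> avg (fun _ : 'I_N => a) = a.
Proof.
move=> N0; rewrite /avg sumr_const card_ord -(mulr_natr a) mulfK//.
by rewrite pnatr_eq0 -lt0n.
Qed.

Lemma le_avg F G : (forall r, F r <= G r) -> avg F <= avg G.
Proof.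
by move=> FG; rewrite /avg ler_wpM2r ?invr_ge0// ler_sum.
Qed.

Lemma avg_ge0 F : (forall r, 0 <= F r) -> 0 <= avg F.
Proof. by move=> F0; rewrite /avg divr_ge0// sumr_ge0. Qed.

End avg_theory.

Lemma lt_invsqrt (R : realType) (x y : R) : 0 <= x -> 0 < y ->
  x ^+ 2 * y < 1 -> x < (Num.sqrt y)^-1.
Proof.
move=> x0 y0 xy; have sy : 0 < Num.sqrt y by rewrite sqrtr_gt0.
rewrite -(ltr_pM2r sy) mulVf ?gt_eqF// -(ltr_pXn2r (n := 2))// ?nnegrE//.
  by rewrite exprMn sqr_sqrtr 1?ltW// expr1n.
by rewrite mulr_ge0// ltW.
Qed.

(* The hypotheses on u are the exact moments of |D_l / l|^2, where D_l is the
   Dirichlet kernel with l terms *)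
Section low_exponents.
Context (R : realType) (N : nat) (u : 'I_N -> R) (l : R).
Hypothesis l3 : 3 <= l.
Hypothesis u01 : forall r, 0 <= u r <= 1.
Hypothesis avg1 : avg u = l^-1.
Hypothesis avg2 : avg (fun r => u r ^+ 2) = (2 / 3 + (l ^+ 2)^-1 / 3) / l.
Hypothesis avg3 : avg (fun r => u r ^+ 3) =
  (11 / 20 + (l ^+ 2)^-1 / 4 + (l ^+ 2)^-1 ^+ 2 / 5) / l.

Let eps : R := (l ^+ 2)^-1.

Let eps_bnd : 0 < eps <= 9^-1.
Proof.
have l9 : 9 <= l ^+ 2 by have := l3; nra.
by rewrite invr_gt0 lef_pV2 ?posrE//; lra.
Qed.

(** The factor 1 / l cancels against l^2 - 1 = l^2 (1 - eps), which leaves a condition where l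
    enters only through [eps]. *)
Let lt_moment (P Y : R) : 0 < P -> 0 <= Y -> Y ^+ 2 * P * (1 - eps) < 1 ->
  Y / l < (Num.sqrt (P * (l ^+ 2 - 1)))^-1.
Proof.
move=> P0 Y0 YP; have l0 : 0 < l := lt_le_trans (ltr0Sn _ _) l3.
apply: lt_invsqrt; first by rewrite divr_ge0// ltW.
  by rewrite mulr_gt0//; have := l3; nra.
suff -> : (Y / l) ^+ 2 * (P * (l ^+ 2 - 1)) = Y ^+ 2 * P * (1 - eps) by [].
by rewrite /eps; field; rewrite gt_eqF.
Qed.

(** The chord between u and u^2 would require (1 - q / 3)^2 (1 + q) <= 1 as eps tends to 0, false
    for small q. The quadratic bound of u^q brings in the third moment and repairs the slope at q =
    0. *)
Let avg_powR12 (q : R) : 0 <= q <= 1 ->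
  avg (fun r => u r `^ (1 + q)) < (Num.sqrt ((1 + q) * (l ^+ 2 - 1)))^-1.
Proof.
move=> q01; have /andP[q0 q1] := q01; have /andP[e0 e1] := eps_bnd.
have l0 : 0 < l := lt_le_trans (ltr0Sn _ _) l3.
pose e : R := expR 1; pose k := 6 / 25 * (q * (1 - q)).
have elo : 27 / 10 <= e := expR1_ge R; have ehi : e <= 11 / 4 := expR1_le R.
pose m1 := 2 / 3 + eps / 3; pose m2 := 11 / 20 + eps / 4 + eps ^+ 2 / 5.
pose V := e ^+ 2 * m2 - 2 * e * m1 + 1.
pose Br := 1 + q * (e * m1 - 1) - k * V.
have avgu : avg (fun r => u r `^ (1 + q)) <= expR (- q) * Br / l.
  apply: (@le_trans _ _ (avg (fun r => expR (- q) *
      ((1 - q - k) * u r + (q * e + 2 * k * e) * u r ^+ 2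
       - k * e ^+ 2 * u r ^+ 3)))).
    apply: le_avg => r; have /andP[u0 u1] := u01 r.
    rewrite powRD ?powRr1//; last by apply/implyP => /eqP; lra.
    have := ler_wpM2l u0 (powR_le_quadratic q01 (u01 r)).
    by move=> /le_trans; apply; rewrite le_eqVlt -/e; apply/orP; left;
       apply/eqP; rewrite /k; ring.
  rewrite avgZ avgB avgD !avgZ avg1 avg2 avg3 -/eps le_eqVlt.
  apply/orP; left; apply/eqP; rewrite /Br /V /m1 /m2.
  by field; rewrite gt_eqF.
apply: le_lt_trans avgu _.
(* [G] majorizes the part of [Br] without eps. Its slope 12/25 is below 1/2, which G^2 (1 + q) <=
   e^(2 q) requires to first order. *)
pose G := 1 + 12 / 25 * q + 9 / 25 * q ^+ 2.
have V0 : 11 / 20 * e ^+ 2 - 4 / 3 * e + 1 <= V.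
  rewrite /V /m1 /m2.
  have : 0 <= eps * (e * (e / 4 - 2 / 3)).
    by rewrite !mulr_ge0//; lra.
  have : 0 <= e ^+ 2 * eps ^+ 2 by rewrite mulr_ge0// sqr_ge0.
  lra.
have BrG : Br <= G + 11 / 12 * (eps * q).
  have : q * (2 / 3 * e - 1 - 6 / 25 * ((1 - q) * V)) <=
         q * (12 / 25 + 9 / 25 * q).
    rewrite ler_wpM2l//.
    have W : 163 / 100 * e - 3 <= V.
      by apply: le_trans V0; have := sqr_ge0 (e - 27 / 10); lra.
    have : (1 - q) * (163 / 100 * e - 3) <= (1 - q) * V.
      by rewrite ler_wpM2l//; lra.
    have : 0 <= q * (11 / 4 - e) by apply: mulr_ge0 => //; lra.
    lra.
  have : eps * q * e <= eps * q * (11 / 4).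
    by rewrite ler_wpM2l// mulr_ge0// ltW.
  rewrite /Br /G /k /m1; lra.
(* The factor 1 + eps / 2 is affordable because (1 + eps / 2)^2 (1 - eps) = 1 - 3 eps^2 / 4 - eps^3
   / 4. At q = 0 this is the only source of strictness. *)
have GE : G + 11 / 12 * (eps * q) <= G * (1 + eps / 2).
  rewrite mulrDr mulr1 lerD2l /G.
  suff : 11 / 12 * q <= (1 + 12 / 25 * q + 9 / 25 * q ^+ 2) / 2 by nra.
  nra.
have Br0 : 0 <= Br.
  have V2 : V <= 2.
    by rewrite /V /m1 /m2; nra.
  have k1 : k <= 6 / 25 by rewrite /k; nra.
  have k0 : 0 <= k by rewrite /k; nra.
  have : 0 <= q * (e * m1 - 1) by rewrite mulr_ge0// /m1; nra.
  rewrite /Br; nra.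
have T := @expR_ge_taylor4 R (2 * q) _.
have G2 : G ^+ 2 * (1 + q) <= expR (2 * q).
  apply: le_trans (T _); last by lra.
  rewrite /G.
  (* With q^5 absorbed into q^4, the comparison with the Taylor polynomial holds coefficient by
     coefficient. *)
  have q2 : q ^+ 5 <= q ^+ 4 by rewrite exprSr ler_piMr ?exprn_ge0.
  have := exprn_ge0 2 q0; have := exprn_ge0 3 q0; have := exprn_ge0 4 q0.
  lra.
apply: lt_moment; first by lra.
  by rewrite mulr_ge0// expR_ge0.
have eE : expR (- q) ^+ 2 * expR (2 * q) = 1.
  by rewrite -expRM_natl -expRD mulrN addNr expR0.
have : (expR (- q) * Br) ^+ 2 * (1 + q) * (1 - eps) <=
  expR (- q) ^+ 2 * expR (2 * q) * ((1 + eps / 2) ^+ 2 * (1 - eps)).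
  have -> : (expR (- q) * Br) ^+ 2 * (1 + q) * (1 - eps) =
    expR (- q) ^+ 2 * (Br ^+ 2 * (1 + q) * (1 - eps)) by ring.
  rewrite -[leRHS]mulrA ler_wpM2l ?sqr_ge0//.
  rewrite [leRHS]mulrA ler_wpM2r//; first by lra.
  apply: (@le_trans _ _ ((G * (1 + eps / 2)) ^+ 2 * (1 + q))).
    rewrite ler_wpM2r//; first by lra.
    by rewrite lerXn2r ?nnegrE//; lra.
  rewrite exprMn mulrAC ler_wpM2r// sqr_ge0//.
move=> /le_lt_trans; apply; rewrite eE mul1r.
nra.
Qed.

(** At P = 2 there is room, (2/3)^2 * 2 = 8/9, so the chord between u^2 and u^3 is enough. *)
Let avg_powR23 (t : R) : 0 <= t <= 1 ->
  avg (fun r => u r `^ (2 + t)) < (Num.sqrt ((2 + t) * (l ^+ 2 - 1)))^-1.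
Proof.
move=> t01; have /andP[t0 t1] := t01; have /andP[e0 e1] := eps_bnd.
have l0 : 0 < l := lt_le_trans (ltr0Sn _ _) l3.
pose m1 := 2 / 3 + eps / 3; pose m2 := 11 / 20 + eps / 4 + eps ^+ 2 / 5.
pose Y := (1 - t) * m1 + t * m2.
apply: (@le_lt_trans _ _ (Y / l)).
  apply: (@le_trans _ _ (avg (fun r => (1 - t) * u r ^+ 2 + t * u r ^+ 3))).
    apply: le_avg => r; have /andP[u0 u1] := u01 r.
    rewrite powRD; last by apply/implyP => /eqP; lra.
    rewrite powR_mulrn//.
    apply: le_trans (ler_wpM2l (sqr_ge0 _) (powR_bernoulli t01 u0)) _.
    by rewrite le_eqVlt; apply/orP; left; apply/eqP; ring.
  rewrite avgD !avgZ avg2 avg3 /Y /m1 /m2 -/eps le_eqVlt.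
  by apply/orP; left; apply/eqP; ring.
have Y1 : Y <= (2 / 3 - 7 / 60 * t) * (1 + 61 / 100 * eps).
  rewrite /Y /m1 /m2.
  have : eps ^+ 2 <= eps / 9 by nra.
  have : 0 <= t * eps by rewrite mulr_ge0// ltW.
  nra.
have Y0 : 0 <= Y.
  by rewrite /Y /m1 /m2 addr_ge0// mulr_ge0//; nra.
apply: lt_moment => //; first by lra.
(* After t^3 <= t^2 the left side is a concave quadratic with its maximum near t = 29/50. *)
have Z1 : (2 / 3 - 7 / 60 * t) ^+ 2 * (2 + t) <= 93 / 100.
  have : t ^+ 3 <= t ^+ 2 by rewrite exprSr ler_piMr ?sqr_ge0.
  have := sqr_ge0 (t - 29 / 50); lra.
have Z2 : (1 + 61 / 100 * eps) ^+ 2 * (1 - eps) <= 103 / 100.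
  have : 0 <= eps ^+ 2 * (eps + 1) by rewrite mulr_ge0 ?sqr_ge0//; lra.
  have := sqr_ge0 eps; lra.
have Z20 : 0 <= (1 + 61 / 100 * eps) ^+ 2 * (1 - eps).
  by rewrite mulr_ge0 ?sqr_ge0//; lra.
apply: (@le_lt_trans _ _ (((2 / 3 - 7 / 60 * t) ^+ 2 * (2 + t)) *
   ((1 + 61 / 100 * eps) ^+ 2 * (1 - eps)))); last by nra.
have -> : (2 / 3 - 7 / 60 * t) ^+ 2 * (2 + t) *
   ((1 + 61 / 100 * eps) ^+ 2 * (1 - eps)) =
  ((2 / 3 - 7 / 60 * t) * (1 + 61 / 100 * eps)) ^+ 2 * (2 + t) * (1 - eps).
  by ring.
rewrite ler_wpM2r//; first by lra.
rewrite ler_wpM2r//; first by lra.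
by rewrite lerXn2r ?nnegrE//; lra.
Qed.

Lemma avg_powR_low (P : R) : 1 <= P <= 3 ->
  avg (fun r => u r `^ P) < (Num.sqrt (P * (l ^+ 2 - 1)))^-1.
Proof.
move=> /andP[P1 P3]; have [P2|/ltW P2] := lerP P 2.
  have := @avg_powR12 (P - 1); rewrite [1 + _]addrC subrK; apply; lra.
have := @avg_powR23 (P - 2); rewrite [2 + _]addrC subrK; apply; lra.
Qed.

End low_exponents.

(** * Averages of trigonometric functions over equally spaced angles *)

Definition grid (R : realType) (N : nat) (r : 'I_N) : R := pi * r%:R / N%:R.

(** Frequencies are counted in the double angle: |D_l|^2 is a polynomial in cos 2x, and on [grid]
    the angle 2x runs over N equally spaced points of the circle. *)
Definition cosz (R : realType) (z : int) (x : R) : R := cos (z%:~R * (x *+ 2)).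

Section cosz_theory.
Context (R : realType).
Implicit Types (x : R) (z : int) (N : nat).

Lemma cosz0 x : cosz 0 x = 1. Proof. by rewrite /cosz mul0r cos0. Qed.

Lemma coszN z x : cosz (- z) x = cosz z x.
Proof. by rewrite /cosz mulrNz mulNr cosN. Qed.

Lemma coszM z1 z2 x :
  cosz z1 x * cosz z2 x = (cosz (z1 + z2) x + cosz (z1 - z2) x) / 2.
Proof. by rewrite /cosz !intrD mulrNz !mulrDl mulNr cosD cosB; field. Qed.

Lemma sin_nat_pi (m : nat) : sin (m%:R * pi) = 0 :> R.
Proof.
elim: m => [|m IH]; first by rewrite mul0r sin0.
by rewrite -natr1 mulrDl mul1r sinDpi IH oppr0.
Qed.

(** Telescoping of 2 sin y cos (2 r y) = sin ((2 r + 1) y) - sin ((2 r - 1) y). *)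
Lemma sum_cos_odd (y : R) (n : nat) :
  2 * sin y * (\sum_(r < n) cos (r%:R * (y *+ 2))) =
  sin (n%:R * (y *+ 2) - y) + sin y.
Proof.
elim: n => [|n IH].
  by rewrite big_ord0 mulr0 mul0r sub0r sinN addNr.
rewrite big_ord_recr/= mulrDr IH.
have -> : n.+1%:R * (y *+ 2) - y = n%:R * (y *+ 2) + y.
  by rewrite -natr1; ring.
by rewrite sinB sinD; ring.
Qed.

Lemma avg_cos_nat N (m : nat) : (0 < m < N)%N ->
  avg (fun r : 'I_N => cosz m%:Z (grid R r)) = 0.
Proof.
move=> /andP[m0 mN]; have N0 : (0 < N)%N by apply: leq_trans mN.
pose y : R := m%:R * pi / N%:R.
have Nn0 : N%:R != 0 :> R by rewrite pnatr_eq0 -lt0n.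
have sy : sin y != 0.
  rewrite gt_eqF// sin_gt0_pi// /y divr_gt0 ?mulr_gt0 ?pi_gt0 ?ltr0n//=.
  by rewrite ltr_pdivrMr ?ltr0n// mulrC ltr_pM2l ?pi_gt0// ltr_nat.
have := sum_cos_odd y N.
have -> : N%:R * (y *+ 2) - y = (m + m)%:R * pi - y.
  by rewrite /y natrD; field.
rewrite sinB sin_nat_pi mul0r sub0r.
have -> : cos ((m + m)%:R * pi) = 1 :> R.
  have := cos2Dsin2 (m%:R * pi : R).
  by rewrite natrD mulrDl cosD -!expr2 sin_nat_pi expr0n/= addr0 subr0.
rewrite mul1r addNr => /eqP; rewrite !mulf_eq0 pnatr_eq0/= (negbTE sy)/= => /eqP s0.
rewrite /avg (eq_bigr (fun r : 'I_N => cos (r%:R * (y *+ 2)))) ?s0 ?mul0r//.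
by move=> r _; rewrite /cosz /grid /y; congr cos; rewrite -pmulrn; field.
Qed.

Lemma avg_cosz N z : (`|z| < N)%N ->
  avg (fun r : 'I_N => cosz z (grid R r)) = (z == 0)%:R.
Proof.
move=> zN; have [->|z0] := eqVneq z 0.
  by rewrite (eq_avg (fun r => cosz0 _)) avg_cst//; apply: leq_ltn_trans zN.
have [zE|zE] : z = `|z|%N%:Z \/ z = - `|z|%N%:Z by lia.
  by rewrite zE avg_cos_nat//; lia.
rewrite zE (eq_avg (fun r => coszN _ _)) avg_cos_nat//; lia.
Qed.

Lemma avg_coszM N z1 z2 : (`|z1| + `|z2| < N)%N ->
  avg (fun r : 'I_N => cosz z1 (grid R r) * cosz z2 (grid R r)) =
  ((z1 + z2 == 0)%:R + (z1 - z2 == 0)%:R) / 2.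
Proof.
move=> zN; rewrite (eq_avg (fun r => coszM _ _ _)).
under eq_avg do rewrite mulrC.
by rewrite avgZ avgD !avg_cosz; [rewrite mulrC|lia..].
Qed.

Lemma avg_coszM3 N z1 z2 z3 : (`|z1| + `|z2| + `|z3| < N)%N ->
  avg (fun r : 'I_N =>
         cosz z1 (grid R r) * cosz z2 (grid R r) * cosz z3 (grid R r)) =
  ((z1 + z2 + z3 == 0)%:R + (z1 + z2 - z3 == 0)%:R
   + (z1 - z2 + z3 == 0)%:R + (z1 - z2 - z3 == 0)%:R) / 4.
Proof.
move=> zN.
have E (r : 'I_N) : cosz z1 (grid R r) * cosz z2 (grid R r) * cosz z3 (grid R r) =
  2^-1 * (cosz (z1 + z2) (grid R r) * cosz z3 (grid R r)
          + cosz (z1 - z2) (grid R r) * cosz z3 (grid R r)).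
  by rewrite coszM; ring.
rewrite (eq_avg E) avgZ avgD !avg_coszM; [|lia..].
by field.
Qed.

(** * Central binomial coefficients and averages of powers of cos^2 *)

Lemma bin_double_succ (a z : nat) :
  'C(a.+1.*2, a.+1 + z) =
  ('C(a.*2, a + z.+1) + 2 * 'C(a.*2, a + z)
   + 'C(a.*2, a + (if z is z'.+1 then z' else 1)))%N.
Proof.
rewrite doubleS addSn binS.
(* At z = 0 the neighbour z - 1 is reflected to 1 by the symmetry of the binomials, just as
   [cosz (-1)] equals [cosz 1]. *)
case: z => [|z].
  rewrite addn0 binS; case: a => [|a]; first by rewrite !bin0 !bin0n.
  rewrite [X in (_ + X)%N]binS.
  have -> : 'C(a.+1.*2, a) = 'C(a.+1.*2, a.+1 + 1).
    by rewrite -(bin_sub (n := a.+1.*2) (m := a)); [congr binomial; lia|lia].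
  by rewrite !addn1; lia.
by rewrite addnS !binS !addnS; lia.
Qed.

(** Multiplication by cos^2 x = (2 + e^(2ix) + e^(-2ix)) / 4 acts on Fourier coefficients as two
    steps of Pascal's rule. All frequencies z are included because the induction on a moves between
    neighbouring ones. *)
Lemma avg_cos2X_cosz N (a z : nat) : (a + z < N)%N ->
  avg (fun r : 'I_N => (cos (grid R r) ^+ 2) ^+ a * cosz z%:Z (grid R r))
  = 'C(a.*2, a + z)%:R / 4 ^+ a.
Proof.
elim: a z => [|a IH] z azN.
  under eq_avg do rewrite expr0 mul1r.
  rewrite avg_cosz//= expr0 divr1 add0n bin0n; case: z azN => //.
have E (r : 'I_N) : (cos (grid R r) ^+ 2) ^+ a.+1 * cosz z%:Z (grid R r) =
  4^-1 * ((cos (grid R r) ^+ 2) ^+ a * cosz z.+1%:Z (grid R r)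
   + 2 * ((cos (grid R r) ^+ 2) ^+ a * cosz z%:Z (grid R r))
   + (cos (grid R r) ^+ 2) ^+ a *
     cosz (if z is z'.+1 then z' else 1)%:Z (grid R r)).
  have -> : z.+1%:Z = z%:Z + 1 by lia.
  have := coszM z%:Z 1 (grid R r).
  have -> : cosz (z%:Z - 1) (grid R r) =
            cosz (if z is z'.+1 then z' else 1)%:Z (grid R r).
    by case: (z) => [|z']; [rewrite sub0r coszN | congr cosz; lia].
  have -> : cosz 1 (grid R r) = 2 * cos (grid R r) ^+ 2 - 1.
    by rewrite /cosz mul1r cos_mulr2n; ring.
  set c0 := cosz z%:Z _; set c1 := cosz (z%:Z + 1) _; set c2 := cosz _ _.
  move=> e.
  have -> : c1 = 2 * (c0 * (2 * cos (grid R r) ^+ 2 - 1)) - c2.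
    by rewrite e; field.
  by rewrite exprS; field.
rewrite (eq_avg E) avgZ !avgD avgZ !IH; [|case: z azN {E}; lia|lia..].
rewrite bin_double_succ exprS; set b1 := binomial _ _; set b2 := binomial _ _; set b3 := binomial _ _.
by field; rewrite expf_neq0.
Qed.

Definition wallis (a : nat) : R := 'C(a.*2, a)%:R / 4 ^+ a.

Lemma wallisS a : wallis a.+1 = wallis a * (2 * a%:R + 1) / (2 * a%:R + 2).
Proof.
have : (a.+1 * (a.+1 * 'C(a.+1.*2, a.+1)) = a.+1 * (2 * (a.*2.+1 * 'C(a.*2, a))))%N.
  rewrite doubleS -mul_bin_diag; congr (_ * _)%N.
  have -> : 'C(a.*2.+1, a) = 'C(a.*2.+1, a.+1).
    by rewrite -(bin_sub (n := a.*2.+1) (m := a)); [congr binomial; lia|lia].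
  by have /= -> := mul_bin_diag a.*2.+1 a; lia.
move=> /eqP; rewrite eqn_pmul2l// /wallis exprS.
move: 'C(_, _) 'C(_, _) => Y X /eqP /(congr1 (fun n : nat => n%:R : R)) e.
have a0 : a%:R + 1 != 0 :> R by rewrite natr1 pnatr_eq0.
have {}e : (a%:R + 1) * X%:R = 2 * ((2 * a%:R + 1) * Y%:R) :> R.
  by move: e; rewrite !natrM -!natr1 -muln2 natrM => ->; ring.
have a0' : 2 * a%:R + 2 != 0 :> R.
  by rewrite (_ : _ + 2 = 2 * (a%:R + 1)) ?mulf_neq0//; ring.
have f0 : (4 : R) ^+ a != 0 by rewrite expf_neq0.
apply: (mulfI a0); rewrite mulrA e.
by field; rewrite a0' f0.
Qed.

Lemma wallis_ge0 a : 0 <= wallis a.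
Proof. by rewrite /wallis divr_ge0// exprn_ge0. Qed.

(* The shift 3/10 makes the sequence decreasing; 1/4, the best asymptotic
   shift, would make it increasing *)
Lemma wallis_decr a b : (0 < a <= b)%N ->
  wallis b ^+ 2 * (b%:R + 3 / 10) <= wallis a ^+ 2 * (a%:R + 3 / 10).
Proof.
move=> /andP[a0]; elim: b => [|b IH]; first by rewrite leqNgt a0.
rewrite leq_eqVlt => /predU1P[->//|]; rewrite ltnS => ab.
apply: le_trans (IH ab); rewrite wallisS -(natr1 b).
have : 1 <= b%:R :> R by rewrite ler1n (leq_trans a0).
move: (wallis b) (b%:R : R) => w y y1.
have -> : (w * (2 * y + 1) / (2 * y + 2)) ^+ 2 * (y + 1 + 3 / 10) =
  w ^+ 2 * ((2 * y + 1) ^+ 2 * (y + 13 / 10) / (2 * y + 2) ^+ 2).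
  by field; lra.
rewrite ler_wpM2l ?sqr_ge0// ler_pdivrMr ?exprn_gt0//; last lra.
nra.
Qed.

(** A real exponent lies between integers a and a + 1, and Bernoulli bounds the average by the chord
    of [wallis]. The loss is absorbed by the shift 3/10, present in the hypothesis on K and absent
    from the conclusion. *)
Lemma avg_cos2_powR_le N (x K : R) (a0 : nat) : (0 < a0)%N -> a0%:R <= x ->
  x + 1 < N%:R -> wallis a0 ^+ 2 * (a0%:R + 3 / 10) <= K ->
  avg (fun r : 'I_N => (cos (grid R r) ^+ 2) `^ x) ^+ 2 * x <= K.
Proof.
move=> a00 a0x xN wK.
have x0 : 0 <= x := le_trans (ler0n _ _) a0x.
have [a [ax xa]] : exists a : nat, a%:R <= x /\ x < a.+1%:R.
  by exists (Num.truncn x); apply/andP; exact: truncn_itv.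
pose t := x - a%:R.
have a0a : (a0 <= a)%N by rewrite -ltnS -(ltr_nat R); exact: le_lt_trans xa.
have t01 : 0 <= t <= 1 by rewrite /t -natr1 in xa *; lra.
have xE : x = a%:R + t by rewrite /t; ring.
have a1 : 1 <= a%:R :> R by rewrite ler1n (leq_trans a00).
have aN : (a.+1 < N)%N by rewrite -(ltr_nat R) -natr1; lra.
have W b : (b < N)%N ->
    avg (fun r : 'I_N => (cos (grid R r) ^+ 2) ^+ b) = wallis b.
  move=> bN; rewrite /wallis; have := @avg_cos2X_cosz N b 0; rewrite addn0 => /(_ bN) <-.
  by apply: eq_avg => r; rewrite cosz0 mulr1.
have le1 : avg (fun r : 'I_N => (cos (grid R r) ^+ 2) `^ x) <=
    wallis a * (1 - t / (2 * a%:R + 2)).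
  have -> : wallis a * (1 - t / (2 * a%:R + 2)) =
            (1 - t) * wallis a + t * wallis a.+1.
    by rewrite wallisS; field; lra.
  rewrite -!W//; last exact: ltn_trans aN.
  rewrite -!avgZ -avgD; apply: le_avg => r.
  have := sqr_ge0 (cos (grid R r)); move: (_ ^+ 2) => c c0.
  rewrite xE powRD ?powR_mulrn//; last first.
    by apply/implyP => /eqP; lra.
  apply: le_trans (ler_wpM2l (exprn_ge0 _ c0) (powR_bernoulli t01 c0)) _.
  by rewrite exprSr le_eqVlt; apply/orP; left; apply/eqP; ring.
have ge0 : 0 <= avg (fun r : 'I_N => (cos (grid R r) ^+ 2) `^ x).
  by apply: avg_ge0 => r; exact: powR_ge0.
apply: le_trans wK.
apply: le_trans (wallis_decr (a := a0) (b := a) _); last by rewrite a00.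
apply: (@le_trans _ _ ((wallis a * (1 - t / (2 * a%:R + 2))) ^+ 2 * x)).
  by rewrite ler_wpM2r// lerXn2r ?nnegrE//; exact: le_trans le1.
rewrite exprMn -mulrA ler_wpM2l ?sqr_ge0//.
have -> : (1 - t / (2 * a%:R + 2)) ^+ 2 * x =
  (2 * a%:R + 2 - t) ^+ 2 * x / (2 * a%:R + 2) ^+ 2 by field; lra.
rewrite ler_pdivrMr ?exprn_gt0//.
(* With y = a, the product (2 y + 2 - t)^2 (y + t) is maximal at t = 2/3, with value 4 (y + 2/3)^3;
   this is its distance to the maximum. *)
have : 0 <= (t - 2 / 3) ^+ 2 * (3 * a%:R + 8 / 3 - t).
  by rewrite mulr_ge0 ?sqr_ge0//; lra.
rewrite xE; set y : R := a%:R => H.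
have : 0 <= y ^+ 2 by rewrite sqr_ge0.
suff : 4 * (y + 2 / 3) ^+ 3 <= (y + 3 / 10) * (2 * y + 2) ^+ 2 by lra.
nra.
Qed.

End cosz_theory.

(** * The Fejer kernel *)

Lemma sum_delta (R : pzRingType) (F : nat -> R) (l m : nat) :
  \sum_(1 <= k < l) F k * (k == m)%:R = if (0 < m < l)%N then F m else 0.
Proof.
case: ifPn => [ml|ml]; last first.
  rewrite big_nat_cond big1// => k /andP[kl _].
  by case: eqVneq kl => [->|_ _]; rewrite ?mulr0// (negbTE ml).
rewrite (bigD1_seq m) ?mem_index_iota ?iota_uniq//= eqxx mulr1.
by rewrite big1 ?addr0// => k /negbTE ->; rewrite mulr0.
Qed.

Definition triangle_sum (R : realType) (l : nat) (x : R) : R :=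
  \sum_(1 <= j < l) (l - j)%:R * cosz j%:Z x.

(** This is |D_l|^2, that is (sin (l x) / sin x)^2, written as a cosine polynomial: no division at
    sin x = 0, and averages can be read off. *)
Definition fejer (R : realType) (l : nat) (x : R) : R :=
  l%:R + 2 * triangle_sum l x.

Section fejer_theory.
Context (R : realType).
Implicit Types (x : R) (l N : nat).

Lemma fejerS l x :
  fejer l.+1 x = fejer l x + 1 + 2 * \sum_(1 <= j < l.+1) cosz j%:Z x.
Proof.
rewrite /fejer /triangle_sum.
have -> : \sum_(1 <= j < l.+1) (l.+1 - j)%:R * cosz j%:Z x =
  \sum_(1 <= j < l.+1) (l - j)%:R * cosz j%:Z x
  + \sum_(1 <= j < l.+1) cosz j%:Z x.
  rewrite -big_split/=; apply: eq_big_nat => j /andP[j0 jl].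
  by rewrite subSn// -natr1 mulrDl mul1r.
have -> : \sum_(1 <= j < l.+1) (l - j)%:R * cosz j%:Z x =
          \sum_(1 <= j < l) (l - j)%:R * cosz j%:Z x.
  case: l => [|l]; first by rewrite !big_geq.
  by rewrite big_nat_recr//= subnn mul0r addr0.
by rewrite -natr1; ring.
Qed.

Lemma fejerE l x :
  fejer l x = (\sum_(a < l) cos (a%:R * (x *+ 2))) ^+ 2
            + (\sum_(a < l) sin (a%:R * (x *+ 2))) ^+ 2.
Proof.
elim: l => [|l IH].
  by rewrite /fejer /triangle_sum !big_ord0 big_geq// expr0n/= !addr0 mulr0 add0r.
rewrite fejerS IH !big_ord_recr/=.
set y := x *+ 2; set A := \sum_(a < l) cos _; set B := \sum_(a < l) sin _.
have -> : \sum_(1 <= j < l.+1) cosz j%:Z x =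
          A * cos (l%:R * y) + B * sin (l%:R * y).
  rewrite big_add1/= big_mkord (reindex_inj rev_ord_inj)/= !mulr_suml -big_split/=.
  apply: eq_bigr => a _; rewrite -cosB -cosN; congr cos.
  by rewrite -pmulrn subnSK// -/y natrB 1?ltnW//; ring.
have := cos2Dsin2 (l%:R * y) => e.
have -> : A ^+ 2 + B ^+ 2 + 1 = A ^+ 2 + B ^+ 2 +
  (cos (l%:R * y) ^+ 2 + sin (l%:R * y) ^+ 2) by rewrite e.
ring.
Qed.

Lemma fejer_ge0 l x : 0 <= fejer l x.
Proof. by rewrite fejerE addr_ge0 ?sqr_ge0. Qed.

Lemma fejer_le l x : fejer l x <= l%:R ^+ 2.
Proof.
have -> : l%:R ^+ 2 = fejer l (0 : R).
  rewrite fejerE (eq_bigr (fun=> 1)) => [|a _]; last by rewrite mul0rn mulr0 cos0.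
  rewrite [in X in _ + X]big1 => [|a _]; last by rewrite mul0rn mulr0 sin0.
  by rewrite sumr_const card_ord expr0n addr0.
rewrite /fejer lerD2l ler_pM2l// ler_sum// => j _.
by rewrite ler_wpM2l// /cosz mul0rn mulr0 cos0 cos_le1.
Qed.

Lemma fejer_sin l x : fejer l x * sin x ^+ 2 = sin (l%:R * x) ^+ 2.
Proof.
(* Real and imaginary parts of sum_(a < l) e^(2iax) = e^(i (l - 1) x) sin (l x) / sin x, multiplied
   by sin x. *)
have [h1 h2] : sin x * (\sum_(a < l) cos (a%:R * (x *+ 2)))
               = sin (l%:R * x) * cos (l%:R * x - x)
            /\ sin x * (\sum_(a < l) sin (a%:R * (x *+ 2)))
               = sin (l%:R * x) * sin (l%:R * x - x).
  elim: l => [|l [IH1 IH2]].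
    by rewrite !big_ord0 mul0r sin0 !mul0r mulr0.
  rewrite !big_ord_recr/= !(mulrDr (sin x)) IH1 IH2 -natr1 mulrDl mul1r addrK.
  have -> : l%:R * (x *+ 2) = l%:R * x + l%:R * x by ring.
  rewrite cosB sinB !sinD !cosD.
  have e := cos2Dsin2 x.
  have {}e : sin x ^+ 2 = 1 - cos x ^+ 2 by rewrite -e; ring.
  by split; ring: e.
have e := cos2Dsin2 (l%:R * x - x).
rewrite fejerE mulrDl -!exprMn ![_ * sin x]mulrC h1 h2 !exprMn -mulrDr e mulr1//.
Qed.

Lemma fejer1 x : fejer 1 x = 1.
Proof. by rewrite /fejer /triangle_sum big_geq// mulr0 addr0. Qed.

Lemma fejer2 x : fejer 2 x = 4 * cos x ^+ 2.
Proof.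
rewrite /fejer /triangle_sum big_nat1/= mul1r /cosz mul1r cos_mulr2n.
ring.
Qed.

Lemma avg_triangle_sum N l : (l <= N)%N ->
  avg (fun r : 'I_N => triangle_sum l (grid R r)) = 0.
Proof.
move=> lN; rewrite /triangle_sum avg_sum big_nat_cond big1// => j.
by rewrite andbT => /andP[j0 jl]; rewrite avgZ avg_cos_nat ?mulr0//; lia.
Qed.

Lemma avg_triangle_sum2 N l : (l + l <= N)%N ->
  avg (fun r : 'I_N => triangle_sum l (grid R r) ^+ 2) =
  (\sum_(1 <= j < l) (l - j)%:R ^+ 2) / 2.
Proof.
move=> lN.
under eq_avg do rewrite /triangle_sum expr2 big_distrlr/=.
rewrite avg_sum mulr_suml; apply: eq_big_nat => i /andP[i0 il].
rewrite avg_sum; under eq_bigr do under eq_avg do rewrite mulrACA.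
rewrite (@eq_big_nat _ _ _ _ _ _ (fun j => (l - i)%:R * (l - j)%:R / 2 * (j == i)%:R)).
  by rewrite sum_delta i0 il/= expr2.
move=> j /andP[j0 jl]; rewrite avgZ avg_coszM; last lia.
rewrite [X in X%:R + _](_ : _ = 0%N); last by apply/eqP; lia.
rewrite add0r [X in X%:R / _](_ : _ = (j == i) :> nat); last by congr nat_of_bool; lia.
ring.
Qed.

(** For positive indices i + j + k = 0 is impossible, and the three relations of type k = i + j
    contribute equally. Truncated subtraction makes the weight [l - (i + j)] vanish when i + j >= l,
    so the sums keep their full range. *)
Lemma avg_triangle_sum3 N l : (l + l + l <= N)%N ->
  avg (fun r : 'I_N => triangle_sum l (grid R r) ^+ 3) =
  3 / 4 * (\sum_(1 <= i < l) \sum_(1 <= j < l)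
             (l - i)%:R * (l - j)%:R * (l - (i + j))%:R).
Proof.
move=> lN; pose t (i : nat) : R := (l - i)%:R.
pose T i j k : R := t i * t j * t k.
have E (r : 'I_N) : triangle_sum l (grid R r) ^+ 3 =
  \sum_(1 <= i < l) \sum_(1 <= j < l) \sum_(1 <= k < l)
    T i j k * (cosz i%:Z (grid R r) * cosz j%:Z (grid R r) * cosz k%:Z (grid R r)).
  rewrite /triangle_sum exprS expr2 big_distrlr/= big_distrlr/=.
  apply: eq_bigr => i _; apply: eq_bigr => j _.
  rewrite mulr_sumr; apply: eq_bigr => k _; rewrite /T /t; ring.
rewrite (eq_avg E) avg_sum; under eq_bigr do rewrite avg_sum.
under eq_bigr do under eq_bigr do rewrite avg_sum.
pose S := \sum_(1 <= i < l) \sum_(1 <= j < l) t i * t j * t (i + j)%N.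
have dl i j : \sum_(1 <= k < l) T i j k * (k == i + j)%N%:R =
              if (0 < i + j)%N then t i * t j * t (i + j)%N else 0.
  rewrite sum_delta; case: (ltnP 0 (i + j)) => //= _.
  case: ltnP => // lij; rewrite /T /t.
  by rewrite (_ : l - (i + j) = 0)%N ?mulr0//; lia.
have S1 : \sum_(1 <= i < l) \sum_(1 <= j < l) \sum_(1 <= k < l)
    T i j k * (k == i + j)%N%:R = S.
  apply: eq_big_nat => i /andP[i0 _]; apply: eq_bigr => j _.
  by rewrite dl addn_gt0 i0.
have S2 : \sum_(1 <= i < l) \sum_(1 <= j < l) \sum_(1 <= k < l)
    T i j k * (j == i + k)%N%:R = S.
  rewrite -S1; apply: eq_bigr => i _; rewrite exchange_big/=.
  apply: eq_bigr => j _; apply: eq_bigr => k _; congr (_ * _); rewrite /T; ring.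
have S3 : \sum_(1 <= i < l) \sum_(1 <= j < l) \sum_(1 <= k < l)
    T i j k * (i == j + k)%N%:R = S.
  rewrite -S2 exchange_big/=; apply: eq_bigr => i _; apply: eq_bigr => j _.
  apply: eq_bigr => k _; congr (_ * _); rewrite /T; ring.
have -> : 3 / 4 * \sum_(1 <= i < l) \sum_(1 <= j < l)
    (l - i)%:R * (l - j)%:R * (l - (i + j))%:R = (S + S + S) / 4 by rewrite -/S; field.
rewrite -{1}S1 -{1}S2 -S3 -!big_split/= mulr_suml.
apply: eq_big_nat => i /andP[i0 il]; rewrite -!big_split/= mulr_suml.
apply: eq_big_nat => j /andP[j0 jl]; rewrite -!big_split/= mulr_suml.
apply: eq_big_nat => k /andP[k0 kl].
rewrite avgZ avg_coszM3; last lia.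
have -> : (i%:Z + j%:Z + k%:Z == 0) = false by lia.
have -> : (i%:Z + j%:Z - k%:Z == 0) = (k == i + j)%N by lia.
have -> : (i%:Z - j%:Z + k%:Z == 0) = (j == i + k)%N by lia.
have -> : (i%:Z - j%:Z - k%:Z == 0) = (i == j + k)%N by lia.
by rewrite add0r -!mulrDr mulrA.
Qed.

Lemma sum_sqr_dist (L : R) (n : nat) :
  \sum_(1 <= j < n.+1) (L - j%:R) ^+ 2 =
  n%:R * L ^+ 2 - L * n%:R * (n%:R + 1)
  + n%:R * (n%:R + 1) * (2 * n%:R + 1) / 6.
Proof.
elim: n => [|n IH]; first by rewrite big_geq//; field.
by rewrite big_nat_recr//= IH -natr1; field.
Qed.

Lemma sum_mul_dist (L M : R) (n : nat) :
  \sum_(1 <= j < n.+1) (L - j%:R) * (M - j%:R) =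
  n%:R * L * M - (L + M) * n%:R * (n%:R + 1) / 2
  + n%:R * (n%:R + 1) * (2 * n%:R + 1) / 6.
Proof.
elim: n => [|n IH]; first by rewrite big_geq//; field.
by rewrite big_nat_recr//= IH -natr1; field.
Qed.

(** The summand is six times the inner sum over j of [avg_triangle_sum3], as evaluated by
    [sum_mul_dist]. The right side is organized by the power sums of degrees 1 to 4. *)
Lemma sum_quartic (L : R) (n : nat) :
  \sum_(1 <= i < n.+1) (L - i%:R) ^+ 2 * (L - i%:R - 1) * (2 * L + i%:R - 1) =
  let P := (L - 1) * (2 * L - 1) in let m := n%:R in
  L ^+ 2 * P * m - (L ^+ 3 + 2 * L * P) * (m * (m + 1) / 2)
  + (L ^+ 2 + P) * (m * (m + 1) * (2 * m + 1) / 6)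
  + L * (m ^+ 2 * (m + 1) ^+ 2 / 4)
  - m * (m + 1) * (2 * m + 1) * (3 * m ^+ 2 + 3 * m - 1) / 30.
Proof.
elim: n => [|n IH]; first by rewrite big_geq//=; field.
by rewrite big_nat_recr//= IH -natr1 /=; field.
Qed.

Lemma avg_fejer N l : (l <= N)%N -> (0 < l)%N ->
  avg (fun r : 'I_N => fejer l (grid R r)) = l%:R.
Proof.
move=> lN l0; rewrite avgD avg_cst; last exact: leq_trans lN.
by rewrite avgZ avg_triangle_sum// mulr0 addr0.
Qed.

Lemma avg_fejer2 N l : (l + l <= N)%N -> (0 < l)%N ->
  avg (fun r : 'I_N => fejer l (grid R r) ^+ 2) = (2 * l%:R ^+ 3 + l%:R) / 3.
Proof.
move=> lN l0.
have E (r : 'I_N) : fejer l (grid R r) ^+ 2 = l%:R ^+ 2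
   + 4 * l%:R * triangle_sum l (grid R r) + 4 * triangle_sum l (grid R r) ^+ 2.
  by rewrite /fejer; ring.
rewrite (eq_avg E) !avgD !avgZ avg_cst ?avg_triangle_sum ?avg_triangle_sum2//; [|lia..].
case: l l0 {lN E} => // n _.
rewrite (eq_big_nat _ _ (F2 := fun j => (n.+1%:R - j%:R) ^+ 2)) => [|j /andP[j0 jn]].
  by rewrite sum_sqr_dist -natr1; field.
by rewrite natrB// ltnW.
Qed.

Lemma avg_fejer3 N l : (l + l + l <= N)%N -> (0 < l)%N ->
  avg (fun r : 'I_N => fejer l (grid R r) ^+ 3) =
  (11 * l%:R ^+ 5 + 5 * l%:R ^+ 3 + 4 * l%:R) / 20.
Proof.
move=> lN l0.
have E (r : 'I_N) : fejer l (grid R r) ^+ 3 = l%:R ^+ 3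
   + 6 * l%:R ^+ 2 * triangle_sum l (grid R r)
   + 12 * l%:R * triangle_sum l (grid R r) ^+ 2
   + 8 * triangle_sum l (grid R r) ^+ 3.
  by rewrite /fejer; ring.
rewrite (eq_avg E) !avgD !avgZ avg_cst ?avg_triangle_sum ?avg_triangle_sum2
  ?avg_triangle_sum3//; [|lia..].
case: l l0 {lN E} => // n _.
rewrite (eq_big_nat _ _ (F2 := fun j => (n.+1%:R - j%:R) ^+ 2)); last first.
  by move=> j /andP[j0 jn]; rewrite natrB// ltnW.
rewrite sum_sqr_dist.
rewrite [X in 3 / 4 * X](eq_big_nat _ _ (F2 := fun i =>
  6^-1 * ((n.+1%:R - i%:R) ^+ 2 * (n.+1%:R - i%:R - 1) * (2 * n.+1%:R + i%:R - 1)))).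
  by rewrite -mulr_sumr sum_quartic -natr1 /=; field.
move=> i /andP[i0 il].
rewrite (@big_cat_nat _ _ _ (n.+1 - i)%N)/=; [|lia..].
rewrite [X in _ + X]big_nat_cond [X in _ + X]big1 ?addr0; last first.
  move=> j; rewrite andbT => /andP[ij jn].
  by rewrite (_ : n.+1 - (i + j) = 0)%N ?mulr0//; lia.
have iE : (n.+1 - i = (n - i).+1)%N by lia.
have iR : (n - i)%:R = n.+1%:R - i%:R - 1 :> R.
  by rewrite -natrB 1?ltnW// iE -natr1 addrK.
rewrite (eq_big_nat _ _ (F2 := fun j =>
   (n.+1%:R - i%:R) * ((n.+1%:R - j%:R) * (n.+1%:R - i%:R - j%:R)))).
  by rewrite -mulr_sumr iE sum_mul_dist iR; field.
move=> j /andP[j0 jn].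
rewrite (natrB _ (_ : i + j <= n.+1)%N); last lia.
rewrite (natrB _ (ltnW il)) (natrB _ (_ : j <= n.+1)%N); last lia.
by rewrite (natrD _ i j); ring.
Qed.

(** [fejer l] only has frequencies below l, so the term cos (2 l x) of sin^2 (l x) is orthogonal to
    it and exactly half of the average survives. *)
Lemma avg_fejer_sin2 N l : (l + l <= N)%N -> (0 < l)%N ->
  avg (fun r : 'I_N => fejer l (grid R r) * sin (l%:R * grid R r) ^+ 2) = l%:R / 2.
Proof.
move=> lN l0.
have E (r : 'I_N) : fejer l (grid R r) * sin (l%:R * grid R r) ^+ 2 =
  2^-1 * (fejer l (grid R r) - (l%:R * cosz l%:Z (grid R r)
     + 2 * \sum_(1 <= j < l) (l - j)%:R * (cosz j%:Z (grid R r) * cosz l%:Z (grid R r)))).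
  have -> : sin (l%:R * grid R r) ^+ 2 = (1 - cosz l%:Z (grid R r)) / 2.
    by rewrite sin2cos2 /cosz -pmulrn mulrnAr cos_mulr2n; field.
  under eq_bigr do rewrite mulrA; rewrite -mulr_suml.
  by rewrite /fejer /triangle_sum; field.
rewrite (eq_avg E) avgZ avgB avg_fejer//; last lia.
rewrite avgD !avgZ.
rewrite avg_cos_nat; last lia.
rewrite avg_sum big_nat_cond big1 => [|j]; first by field.
rewrite andbT => /andP[j0 jl]; rewrite avgZ avg_coszM; last lia.
have -> : (j%:Z + l%:Z == 0) = false by lia.
have -> : (j%:Z - l%:Z == 0) = false by lia.
by rewrite addr0 mul0r mulr0.
Qed.

End fejer_theory.

(** * Main lobe and tail *)

Section lobes.
Context (R : realType).
Implicit Types (x : R) (n l N : nat).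

(** Division-free form of 3 n cot (n x) <= 3 cot x - (n^2 - 1) tan x, the logarithmic derivative of
    the inequality in [sin_mul_le_cos]. *)
Lemma cot_mul_le x n : 0 <= sin x -> 0 < cos x -> 0 <= x -> (0 < n)%N ->
  n%:R * x <= pi ->
  3 * n%:R * cos x * sin x * cos (n%:R * x) <=
  sin (n%:R * x) * (3 * cos x ^+ 2 - (n%:R ^+ 2 - 1) * sin x ^+ 2).
Proof.
move=> s0 c0 x0; elim: n => // -[_ _ _|n IH _ nx].
  by rewrite !mul1r mulr1; lra.
have {IH}:= IH isT (le_trans _ nx); rewrite ler_wpM2r ?ler_nat// => /(_ isT).
have : 0 <= sin (n.+1%:R * x).
  apply: sin_ge0_pi; rewrite mulr_ge0//=; apply: le_trans nx.
  by rewrite ler_wpM2r ?ler_nat.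
have -> : n.+2%:R * x = n.+1%:R * x + x by rewrite -(natr1 n.+1); ring.
rewrite -(natr1 n.+1) sinD cosD.
have : 1 <= n.+1%:R :> R by rewrite ler1n.
move: (n.+1%:R : R) (sin _) (cos _) (sin x) (cos x) s0 c0 => m S C s c s0 c0 m1 S0.
rewrite -subr_ge0 => H.
rewrite -subr_ge0 -(pmulr_rge0 _ (_ : 0 < 3 * m * c)); last first.
  by rewrite !mulr_gt0//; lra.
(* The new difference is the old one times a nonnegative factor, plus a nonnegative remainder. *)
have -> : 3 * m * c * ((S * c + C * s) * (3 * c ^+ 2 - ((m + 1) ^+ 2 - 1) * s ^+ 2)
    - 3 * (m + 1) * c * s * (C * c - S * s)) =
  (S * (3 * c ^+ 2 - (m ^+ 2 - 1) * s ^+ 2) - 3 * m * c * s * C)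
    * (3 * m * c ^+ 2 + ((m + 1) ^+ 2 - 1) * s ^+ 2)
  + S * (m ^+ 2 - 1) * ((m + 1) ^+ 2 - 1) * s ^+ 4 by ring.
have m2 : 0 <= m ^+ 2 - 1 by nra.
have m3 : 0 <= (m + 1) ^+ 2 - 1 by nra.
rewrite addr_ge0// !mulr_ge0 ?exprn_ge0// addr_ge0// !mulr_ge0 ?sqr_ge0//; lra.
Qed.

(* The induction step reduces, by the previous lemma, to
   (1 - (n - 1) v / 3) ^ 3 <= (1 + v) ^ -(n - 1) for v = tan ^ 2 x *)
Lemma sin_mul_le_cos x n : 0 <= sin x -> 0 < cos x -> 0 <= x -> (0 < n)%N ->
  n%:R * x <= pi ->
  sin (n%:R * x) ^+ 3 <= (n%:R * sin x) ^+ 3 * cos x ^+ (n ^ 2).-1.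
Proof.
move=> s0 c0 x0; elim: n => // -[_ _ _|n IH _ nx].
  by rewrite !mul1r expr0 mulr1.
have nx' : n.+1%:R * x <= pi.
  by apply: le_trans nx; rewrite ler_wpM2r ?ler_nat.
have {IH} := IH isT nx'; have := cot_mul_le s0 c0 x0 (ltn0Sn n) nx'.
have S0 : 0 <= sin (n.+1%:R * x).
  by apply: sin_ge0_pi; rewrite mulr_ge0.
have S1 : 0 <= sin (n.+2%:R * x).
  by apply: sin_ge0_pi; rewrite mulr_ge0.
move: S1; have -> : n.+2%:R * x = n.+1%:R * x + x by rewrite -(natr1 n.+1); ring.
rewrite sinD; set S := sin (n.+1%:R * x) in S0 *; set C := cos (n.+1%:R * x).
set S' := S * _ + _ => S1.
have -> : (n.+2 ^ 2).-1 = ((n.+1 ^ 2).-1 + n.*2 + 3)%N by lia.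
have : 1 <= n.+1%:R :> R by rewrite ler1n.
rewrite -(natr1 n.+1); set m : R := n.+1%:R => m1 H IH.
have mn : m - 1 = n%:R by rewrite /m -natr1 addrK.
pose v := (sin x / cos x) ^+ 2; pose Y := 1 - n%:R * v / 3.
have v0 : 0 <= v by rewrite sqr_ge0.
have vE : v * cos x ^+ 2 = sin x ^+ 2 by rewrite /v; field; rewrite gt_eqF.
have S'le : S' <= S * ((m + 1) / m * cos x * Y).
  rewrite -(ler_pM2l (_ : 0 < 3 * m * cos x)); last by rewrite !mulr_gt0//; lra.
  have -> : 3 * m * cos x * (S * ((m + 1) / m * cos x * Y)) =
     S * (m + 1) * (3 * cos x ^+ 2 - (m - 1) * (v * cos x ^+ 2)).
    by rewrite /Y -mn; field; lra.
  rewrite vE /S'; lra.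
(* Only for [S != 0] does [0 <= S'] force [0 <= Y], the sign used when the bound is cubed. *)
have [S00|Spos] := eqVneq S 0.
  have -> : S' = 0 by apply/eqP; rewrite eq_le S1 andbT (le_trans S'le)// S00 mul0r.
  rewrite expr0n/=; apply: mulr_ge0; apply: exprn_ge0; last exact: ltW.
  by apply: mulr_ge0 => //; lra.
have Y0 : 0 <= Y.
  have : 0 <= S * ((m + 1) / m * cos x * Y) by exact: le_trans S'le.
  rewrite pmulr_rge0 ?lt_def ?Spos// pmulr_rge0//.
  by rewrite mulr_gt0// divr_gt0//; lra.
(* Y <= e^(-n v / 3) gives Y^3 <= (e^(-v))^n, and e^(-v) <= 1 / (1 + v) = cos^2 x. *)
have Yc : Y ^+ 3 <= cos x ^+ n.*2.
  have Ye : Y <= expR (- (n%:R * v / 3)) by apply: le_trans (expR_ge1Dx _).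
  apply: (@le_trans _ _ (expR (- v) ^+ n)).
    rewrite -expRM_natl.
    apply: (@le_trans _ _ (expR (- (n%:R * v / 3)) ^+ 3)).
      by rewrite lerXn2r ?nnegrE// expR_ge0.
    by rewrite -expRM_natl ler_expR; lra.
  rewrite -mul2n exprM lerXn2r ?nnegrE ?expR_ge0 ?sqr_ge0//.
  have := cos2Dsin2 x; rewrite -vE => cv.
  rewrite expRN -[leRHS]invrK lef_pV2 ?posrE ?expR_gt0 ?invr_gt0 ?exprn_gt0//.
  have -> : (cos x ^+ 2)^-1 = 1 + v.
    rewrite -[LHS]mul1r -[X in X * _]cv; field; rewrite gt_eqF//.
  exact: expR_ge1Dx.
apply: (@le_trans _ _ ((S * ((m + 1) / m * cos x * Y)) ^+ 3)).
  by rewrite lerXn2r ?nnegrE//; exact: le_trans S'le.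
have -> : (S * ((m + 1) / m * cos x * Y)) ^+ 3 =
  (S ^+ 3 * Y ^+ 3) * ((m + 1) / m * cos x) ^+ 3 by ring.
have -> : ((m + 1) * sin x) ^+ 3 * cos x ^+ ((n.+1 ^ 2).-1 + n.*2 + 3) =
  ((m * sin x) ^+ 3 * cos x ^+ (n.+1 ^ 2).-1 * cos x ^+ n.*2)
   * ((m + 1) / m * cos x) ^+ 3.
  by rewrite !exprD; field; lra.
have m0 : 0 < m by lra.
apply: ler_wpM2r; last first.
  by apply: ler_pM => //; apply: exprn_ge0.
by apply/exprn_ge0/mulr_ge0; [apply: divr_ge0; lra | exact: ltW].
Qed.

Lemma sin_ratio_le (a b : R) : 0 <= a <= b -> b <= pi -> a * sin b <= b * sin a.
Proof.
move=> /andP[a0 ab] bpi.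
have d1 (x : R) : is_derive x 1 (fun x => sin x - x * cos x) (x * sin x).
  by apply: is_derive_eq; rewrite /GRing.scale/=; ring.
have h1 : 0 <= sin a - a * cos a.
  have := nondecreasing_derive d1 a0; rewrite sin0 mul0r subrr; apply.
  move=> c /andP[c0 ca]; rewrite mulr_ge0// sin_ge0_pi// c0 /=; lra.
have d2 (x : R) : is_derive x 1 (fun x => x * sin a - a * sin x) (sin a - a * cos x).
  by apply: is_derive_eq; rewrite /GRing.scale/=; ring.
have := nondecreasing_derive d2 ab; rewrite subrr subr_ge0; apply.
move=> c /andP[ac cb]; apply: le_trans h1 _; rewrite lerD2l lerN2 ler_wpM2l//.
move: ac; rewrite le_eqVlt => /predU1P[->//|ac].
by rewrite ltW// ltr_cos ?in_itv//=; lra.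
Qed.

End lobes.

(** * The bound for a single factor and all exponents P >= 1 *)

Section key_estimate.
Context (R : realType).
Implicit Types (x : R) (l N : nat).

Lemma sin_pi3 : sin (pi / 3) ^+ 2 = 3 / 4 :> R.
Proof.
have pi0 := @pi_gt0 R.
have s0 : 0 < sin (pi / 3) :> R by rewrite sin_gt0_pi//; lra.
have : sin (pi / 3 + pi / 3 + pi / 3) = 0 :> R.
  by rewrite -(sinpi R); congr sin; field.
rewrite !sinD !cosD; have := cos2Dsin2 (pi / 3 : R).
move: (sin _) (cos _) s0 => s c s0 e h.
have {}h : s * (3 * c ^+ 2 - s ^+ 2) = 0 by rewrite -h; ring.
by move/eqP: h; rewrite mulf_eq0 gt_eqF//= => /eqP h; lra.
Qed.

(** By [sin_ratio_le], l sin (pi / l) increases with l, so l = 3 is the worst case and 27/4 = (3 sin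
    (pi / 3))^2. *)
Lemma tail_sin_ge x l : (3 <= l)%N -> pi / l%:R <= x <= pi / 2 ->
  27 / 4 <= l%:R ^+ 2 * sin x ^+ 2.
Proof.
move=> l3 /andP[lx x2]; have pi0 := @pi_gt0 R.
have l0 : 3 <= l%:R :> R by rewrite (ler_nat R 3).
have pl : pi / l%:R <= pi / 3 :> R.
  by rewrite ler_pM2l// lef_pV2 ?posrE//; lra.
have pl0 : 0 < pi / l%:R :> R by rewrite divr_gt0//; lra.
have := @sin_ratio_le R (pi / l%:R) (pi / 3); rewrite pl ltW//=.
move=> /(_ isT); have -> : pi / 3 <= pi :> R by lra.
move=> /(_ isT); rewrite -!mulrA ler_pM2l// => h.
have {}h : 3 * sin (pi / 3) <= l%:R * sin (pi / l%:R) :> R.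
  have -> : 3 * sin (pi / 3) = 3 * l%:R * (l%:R^-1 * sin (pi / 3)) :> R.
    by field; lra.
  have -> : l%:R * sin (pi / l%:R) = 3 * l%:R * (3^-1 * sin (pi / l%:R)) :> R.
    by field.
  by rewrite ler_pM2l ?mulr_gt0//; lra.
have sx : sin (pi / l%:R) <= sin x.
  move: lx; rewrite le_eqVlt => /predU1P[->//|lx].
  by rewrite ltW// ltr_sin ?in_itv//=; lra.
have s0 : 0 <= sin (pi / 3) :> R by apply: sin_ge0_pi; lra.
have h2 : 3 * sin (pi / 3) <= l%:R * sin x.
  by apply: le_trans h _; rewrite ler_wpM2l//; lra.
have : (3 * sin (pi / 3)) ^+ 2 <= (l%:R * sin x) ^+ 2.
  by rewrite lerXn2r ?nnegrE//; [rewrite mulr_ge0|apply: le_trans h2; rewrite mulr_ge0].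
by rewrite !exprMn sin_pi3; lra.
Qed.

Lemma lobe_or_tail_half x l : (3 <= l)%N -> 0 < x <= pi / 2 ->
  sin (l%:R * x) ^+ 2 ^+ 3
    <= (l%:R ^+ 2 * sin x ^+ 2) ^+ 3 * (cos x ^+ 2) ^+ (l ^ 2).-1
  \/ 27 / 4 <= l%:R ^+ 2 * sin x ^+ 2.
Proof.
move=> l3 /andP[x0 x2]; have pi0 := @pi_gt0 R.
have l0 : 3 <= l%:R :> R by rewrite (ler_nat R 3).
have [lx|lx] := lerP (l%:R * x) pi; [left|right].
  have x3 : x <= pi / 3.
    rewrite ler_pdivlMr//; apply: le_trans lx; rewrite mulrC ler_wpM2r// ltW//.
  have s0 : 0 <= sin x by apply: sin_ge0_pi; lra.
  have c0 : 0 < cos x by apply: cos_gt0_pihalf; lra.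
  have h := @sin_mul_le_cos R x l s0 c0 (ltW x0) (ltnW (ltnW l3)) lx.
  have S0 : 0 <= sin (l%:R * x).
    by apply: sin_ge0_pi; rewrite mulr_ge0// ltW.
  have -> : (cos x ^+ 2) ^+ (l ^ 2).-1 = (cos x ^+ (l ^ 2).-1) ^+ 2.
    by rewrite -!exprM mulnC.
  move: (cos x ^+ _) (sin (l%:R * x)) h S0 => D S h S0.
  have -> : S ^+ 2 ^+ 3 = (S ^+ 3) ^+ 2 by ring.
  have -> : (l%:R ^+ 2 * sin x ^+ 2) ^+ 3 * D ^+ 2 =
            ((l%:R * sin x) ^+ 3 * D) ^+ 2 by ring.
  rewrite lerXn2r ?nnegrE ?exprn_ge0//.
  by apply: le_trans h; rewrite exprn_ge0.
apply: tail_sin_ge => //; rewrite x2 andbT ler_pdivrMr; last lra.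
by rewrite mulrC ltW.
Qed.

(** The lobe bound is cubed so that its exponent is an integer. The tail keeps sin^2 (l x) instead
    of 1, because its average against [fejer] is known and gains a factor 2. *)
Lemma lobe_or_tail x l : (3 <= l)%N -> 0 <= x < pi ->
  let u := fejer l x / l%:R ^+ 2 in
  u ^+ 3 <= (cos x ^+ 2) ^+ (l ^ 2).-1
  \/ u <= 4 / 27 * sin (l%:R * x) ^+ 2.
Proof.
move=> l3 /andP[]; rewrite le_eqVlt => /predU1P[<- _|x0 xpi] u.
have l0 : 3 <= l%:R :> R by rewrite (ler_nat R 3).
have l20 : 0 < l%:R ^+ 2 :> R by rewrite exprn_gt0; lra.
  left; rewrite cos0 expr1n expr1n exprn_ile1// /u.
    by rewrite divr_ge0 ?fejer_ge0// ltW.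
  by rewrite ler_pdivrMr// mul1r fejer_le.
have l0 : 3 <= l%:R :> R by rewrite (ler_nat R 3).
have s0 : 0 < sin x by rewrite sin_gt0_pi// x0.
have b0 : 0 < l%:R ^+ 2 * sin x ^+ 2 by rewrite mulr_gt0 ?exprn_gt0//; lra.
have uE : u * (l%:R ^+ 2 * sin x ^+ 2) = sin (l%:R * x) ^+ 2.
  by rewrite -fejer_sin /u; field; lra.
suff : sin (l%:R * x) ^+ 2 ^+ 3
    <= (l%:R ^+ 2 * sin x ^+ 2) ^+ 3 * (cos x ^+ 2) ^+ (l ^ 2).-1
  \/ 27 / 4 <= l%:R ^+ 2 * sin x ^+ 2.
  case=> h; [left|right].
    by move: h; rewrite -uE exprMn mulrC ler_pM2l// exprn_gt0.
  have u0 : 0 <= u by rewrite divr_ge0 ?fejer_ge0// sqr_ge0.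
  have : u * (27 / 4) <= sin (l%:R * x) ^+ 2 by rewrite -uE ler_wpM2l.
  lra.
have [x2|x2] := lerP x (pi / 2).
  by apply: lobe_or_tail_half => //; rewrite x0.
have := @lobe_or_tail_half (pi - x) l l3.
have -> : sin (pi - x) = sin x by rewrite sinB sinpi cospi; ring.
have -> : cos (pi - x) ^+ 2 = cos x ^+ 2 by rewrite cosB sinpi cospi; ring.
have -> : sin (l%:R * (pi - x)) ^+ 2 = sin (l%:R * x) ^+ 2.
  have := cos2Dsin2 (l%:R * pi : R); rewrite mulrBr sinB sin_nat_pi => e.
  rewrite mul0r sub0r sqrrN exprMn.
  by move: e; rewrite expr0n/= addr0 => ->; rewrite mul1r.
by apply; lra.
Qed.

Lemma grid_itv N (r : 'I_N) : 0 <= grid R r < pi.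
Proof.
have N0 : (0 < N)%N by apply: leq_ltn_trans (ltn_ord r).
rewrite /grid divr_ge0 ?mulr_ge0 ?pi_ge0//= ltr_pdivrMr ?ltr0n//.
by rewrite ltr_pM2l ?pi_gt0// ltr_nat.
Qed.

(** 8 is the least value of P (l^2 - 1) / 3 for P, l >= 3. The exact value 6435/32768 is only just
    below 11/56. *)
Lemma wallis8_le : wallis R 8 <= 11 / 56.
Proof.
have w0 : wallis R 0 = 1 by rewrite /wallis bin0 expr0 divr1.
have w1 : wallis R 1 = 1 / 2 by rewrite wallisS w0; field.
have w2 : wallis R 2 = 3 / 8 by rewrite wallisS w1; field.
have w3 : wallis R 3 = 5 / 16 by rewrite wallisS w2; field.
have w4 : wallis R 4 = 35 / 128 by rewrite wallisS w3; field.
have w5 : wallis R 5 = 63 / 256 by rewrite wallisS w4; field.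
have w6 : wallis R 6 = 231 / 1024 by rewrite wallisS w5; field.
have w7 : wallis R 7 = 429 / 2048 by rewrite wallisS w6; field.
have -> : wallis R 8 = 429 / 2048 * (15 / 16) by rewrite wallisS w7; field.
lra.
Qed.

(** Here a and b come from lobe and tail, scaled by the square root of P (l^2 - 1). The margin is
    thin: 99/101 + (8/729) (7/4) < 1. *)
Lemma lobe_add_tail_lt (a b w : R) : 0 <= w -> w <= 11 / 56 ->
  a ^+ 2 <= 3 * (w ^+ 2 * (8 + 3 / 10)) -> b ^+ 2 <= 3 ->
  a + 8 / 729 * b < 1.
Proof.
move=> w0 w8 aw b3.
have w2 : w * w <= 11 / 56 * (11 / 56) by exact: ler_pM.
have b1 : b <= 7 / 4 by nra.
have a1 : a <= 99 / 101.
  rewrite leNgt; apply/negP => a1.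
  have : 99 / 101 * (99 / 101) < a * a by apply: ltr_pM => //; lra.
  lra.
lra.
Qed.

(* Beyond the exponent 3 the lobe is compared with a power of cos^2, and the
   tail, where u <= 4/27, with u sin^2(l x) *)
Lemma avg_powR_high N l (P : R) : (3 <= l)%N -> 3 <= P -> (l + l <= N)%N ->
  P * (l%:R ^+ 2 - 1) / 3 + 1 < N%:R ->
  avg (fun r : 'I_N => (fejer l (grid R r) / l%:R ^+ 2) `^ P)
  < (Num.sqrt (P * (l%:R ^+ 2 - 1)))^-1.
Proof.
move=> l3 P3 lN PN; have l0 : 3 <= l%:R :> R by rewrite (ler_nat R 3).
have l8 : 8 <= l%:R ^+ 2 - 1 :> R by nra.
have lE : (l ^ 2).-1%:R = l%:R ^+ 2 - 1 :> R.
  by rewrite -natrX -[(l ^ 2)%N in RHS]prednK ?expn_gt0 -?natr1 ?addrK//; lia.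
(* On the tail u^(P - 3) decays faster than [E]; the rate 1/6 is chosen so that E^2 P <= 3 is e^y >=
   1 + y at y = (P - 3) / 3. *)
pose x := P * (l%:R ^+ 2 - 1) / 3; pose E := expR (- ((P - 3) / 6)).
have x8 : 8 <= x by rewrite /x; nra.
have E0 : 0 <= E := expR_ge0 _.
have E2 : E ^+ 2 * P <= 3.
  rewrite /E -expRM_natl mulrN expRN mulrC ler_pdivrMr ?expR_gt0//.
  have := expR_ge1Dx (2 * ((P - 3) / 6)); lra.
have le1 : avg (fun r : 'I_N => (fejer l (grid R r) / l%:R ^+ 2) `^ P) <=
  avg (fun r : 'I_N => (cos (grid R r) ^+ 2) `^ x) + 8 / 729 * E / l%:R.
  (* On the tail u^P = u * u^2 * u^(P - 3) with u^2 <= (4/27)^2 sin^2 (l x); the remaining factor u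
     makes the average computable, and its half turns 16 into 8. *)
  have -> : 8 / 729 * E / l%:R = avg (fun r : 'I_N => 16 / 729 * E / l%:R ^+ 2 *
     (fejer l (grid R r) * sin (l%:R * grid R r) ^+ 2)).
    by rewrite avgZ avg_fejer_sin2//; [field; lra|lia].
  rewrite -avgD; apply: le_avg => r.
  have /= := lobe_or_tail l3 (grid_itv r).
  set u := fejer l _ / _; set c := cos _ ^+ 2; set s := sin _ ^+ 2.
  have u0 : 0 <= u by rewrite divr_ge0 ?fejer_ge0// sqr_ge0.
  have s0 : 0 <= s by exact: sqr_ge0.
  have s1 : s <= 1 by rewrite /s sin2cos2 gerBl sqr_ge0.
  have -> : 16 / 729 * E / l%:R ^+ 2 * (fejer l (grid R r) * s) = 16 / 729 * E * u * s.
    by rewrite /u; field; lra.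
  have c0 : 0 <= c by exact: sqr_ge0.
  clearbody u c s; case=> h.
    apply: ler_wpDr.
      by apply: mulr_ge0 s0; apply: mulr_ge0 u0; apply: mulr_ge0 E0; lra.
    have -> : u `^ P = (u ^+ 3) `^ (P / 3).
      by rewrite -powR_mulrn// -powRrM; congr powR; field.
    have -> : c `^ x = (c ^+ (l ^ 2).-1) `^ (P / 3).
      by rewrite -powR_mulrn// -powRrM lE; congr powR; rewrite /x; field.
    by rewrite ge0_ler_powR ?nnegrE ?exprn_ge0//; lra.
  apply: ler_wpDl; first exact: powR_ge0.
  have u1 : u <= 4 / 27 by apply: le_trans h _; lra.
  move: u0; rewrite le_eqVlt => /predU1P[u0|u0].
    by rewrite -u0 powR0 ?mulr0 ?mul0r// gt_eqF//; lra.
  have -> : u `^ P = u * u ^+ 2 * u `^ (P - 3).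
    rewrite -exprS -powR_mulrn 1?ltW// -powRD; first by congr powR; ring.
    by apply/implyP => _; rewrite gt_eqF.
  have -> : 16 / 729 * E * u * s = u * (16 / 729 * s) * E by ring.
  apply: ler_pM; rewrite ?powR_ge0//.
  - by rewrite mulr_ge0 ?sqr_ge0// ltW.
  - rewrite ler_pM2l//.
    have := ler_pM (ltW u0) (ltW u0) h u1; rewrite -expr2; lra.
  rewrite /powR gt_eqF// /E ler_expR.
  have := @le_ln1Dx R (u - 1); rewrite [1 + _]addrC subrK => /(_ _).
  have -> : -1 < u - 1 by lra.
  move=> /(_ isT); nra.
apply: le_lt_trans le1 _; set M := avg _.
have M0 : 0 <= M by apply: avg_ge0 => r; exact: powR_ge0.
have Mx : M ^+ 2 * x <= wallis R 8 ^+ 2 * (8 + 3 / 10).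
  exact: (avg_cos2_powR_le (a0 := 8)).
have w8 := wallis8_le; have w80 := @wallis_ge0 R 8.
have Pl0 : 0 < P * (l%:R ^+ 2 - 1) by apply: mulr_gt0; lra.
have y2 := sqr_sqrtr (ltW Pl0).
have y0 : 0 < Num.sqrt (P * (l%:R ^+ 2 - 1)) by rewrite sqrtr_gt0.
move: (Num.sqrt _) y2 y0 => y y2 y0.
clearbody M E; rewrite -(ltr_pM2r y0) (mulVf (lt0r_neq0 y0)) mulrDl.
have T2 : (E / l%:R * y) ^+ 2 <= 3.
  have -> : (E / l%:R * y) ^+ 2 = E ^+ 2 * P * (1 - (l%:R ^+ 2)^-1).
    by rewrite !exprMn exprVn y2; field; lra.
  have : 0 <= (l%:R ^+ 2)^-1 :> R by rewrite invr_ge0 sqr_ge0.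
  have : 0 <= E ^+ 2 * P by apply: mulr_ge0 (sqr_ge0 _) _; lra.
  nra.
have M2 : (M * y) ^+ 2 <= 3 * (wallis R 8 ^+ 2 * (8 + 3 / 10)).
  rewrite exprMn y2 (_ : M ^+ 2 * _ = 3 * (M ^+ 2 * x)); last by rewrite /x; field.
  by apply: ler_wpM2l Mx; exact: ler0n.
have -> : 8 / 729 * E / l%:R * y = 8 / 729 * (E / l%:R * y) by rewrite !mulrA.
exact: lobe_add_tail_lt w80 w8 M2 T2.
Qed.

Lemma avg_powR_lt N l (P : R) : (2 <= l)%N -> 1 <= P -> (l + l + l <= N)%N ->
  P * (l%:R ^+ 2 - 1) / 3 + 1 < N%:R ->
  avg (fun r : 'I_N => (fejer l (grid R r) / l%:R ^+ 2) `^ P)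
  < (Num.sqrt (P * (l%:R ^+ 2 - 1)))^-1.
Proof.
rewrite leq_eqVlt => /predU1P[<-|l3] P1 lN PN.
  rewrite (eq_avg (G := fun r => (cos (grid R r) ^+ 2) `^ P)); last first.
    by move=> r; rewrite fejer2; congr powR; field.
  apply: lt_invsqrt.
  - by apply: avg_ge0 => r; exact: powR_ge0.
  - by rewrite mulr_gt0//; lra.
  (* Starting from exponent 1 the constant is (1/2)^2 (1 + 3/10) = 13/40, below the 1/3 required by
     l^2 - 1 = 3. *)
  have := @avg_cos2_powR_le R N P _ 1 isT P1 _ (lexx _).
  have -> : P + 1 < N%:R by move: PN; lra.
  move=> /(_ isT); rewrite /wallis /= expr1 (_ : 'C(2, 1) = 2)//.
  lra.
have l0 : 3 <= l%:R :> R by rewrite (ler_nat R 3).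
have [P3|/ltW P3] := lerP P 3; last by apply: avg_powR_high => //; lia.
have avgE (k : nat) : avg (fun r : 'I_N => (fejer l (grid R r) / l%:R ^+ 2) ^+ k)
   = (l%:R ^+ 2) ^- k * avg (fun r : 'I_N => fejer l (grid R r) ^+ k).
  by rewrite -avgZ; apply: eq_avg => r; rewrite exprMn exprVn mulrC.
have l20 : 0 < l%:R ^+ 2 :> R by rewrite exprn_gt0//; lra.
apply: avg_powR_low => //.
- by move=> r; rewrite divr_ge0 ?fejer_ge0 ?ler_pdivrMr ?mul1r ?fejer_le//= ltW.
- have := avgE 1; under eq_avg do rewrite expr1.
  move=> ->; under eq_avg do rewrite expr1.
  by rewrite avg_fejer; [field; lra|lia..].
- by rewrite avgE avg_fejer2; [field; lra|lia..].
- by rewrite avgE avg_fejer3; [field; lra|lia..].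
- by rewrite P1.
Qed.

End key_estimate.

(** * Reduction of the counting problem *)

Section product_bound.
Context (R : realType).
Local Open Scope complex_scope.

Let cis (t : R) : R[i] := cos t +i* sin t.

Let sqn (z : R[i]) : R := complex.Re z ^+ 2 + complex.Im z ^+ 2.

Let cisD : {morph cis : s t / s + t >-> s * t}.
Proof.
by move=> s t; rewrite /cis cosD sinD; apply/eqP; rewrite eq_complex/= eqxx addrC/= addrC eqxx.
Qed.

Let cis0 : cis 0 = 1.
Proof. by rewrite /cis cos0 sin0. Qed.

Let sqnM : {morph sqn : z w / z * w}.
Proof. by move=> [a b] [c d]; rewrite /sqn/=; ring. Qed.

Let sqn1 : sqn 1 = 1.
Proof. by rewrite /sqn/= expr1n expr0n addr0. Qed.

Let ReD : {morph (@complex.Re R) : z w / z + w}.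
Proof. by move=> [a b] [c d]. Qed.

Let ImD : {morph (@complex.Im R) : z w / z + w}.
Proof. by move=> [a b] [c d]. Qed.

(* The left-hand side is the real part of e^(i phi) prod_i sum_j e^(i a_j) *)
Lemma sum_cos_family (I J : finType) (Q : I -> pred J) (a : J -> R) (phi : R) :
  \sum_(f in family Q) cos (phi + \sum_i a (f i)) <=
  \prod_i Num.sqrt ((\sum_(j | Q i j) cos (a j)) ^+ 2
                    + (\sum_(j | Q i j) sin (a j)) ^+ 2).
Proof.
pose Z := cis phi * \prod_i \sum_(j | Q i j) cis (a j).
have -> : \sum_(f in family Q) cos (phi + \sum_i a (f i)) = complex.Re Z.
  rewrite /Z bigA_distr_big_dep/= mulr_sumr (big_morph _ ReD (erefl : complex.Re 0 = 0)).
  by apply: eq_bigr => f _; rewrite -(big_morph _ cisD cis0) -cisD.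
have -> : \prod_i Num.sqrt ((\sum_(j | Q i j) cos (a j)) ^+ 2
      + (\sum_(j | Q i j) sin (a j)) ^+ 2) = Num.sqrt (sqn Z).
  have -> : sqn Z = \prod_i ((\sum_(j | Q i j) cos (a j)) ^+ 2
      + (\sum_(j | Q i j) sin (a j)) ^+ 2).
    rewrite sqnM {1}/sqn/= cos2Dsin2 mul1r (big_morph _ sqnM sqn1).
    apply: eq_bigr => i _; rewrite /sqn.
    rewrite (big_morph _ ReD (erefl : complex.Re 0 = 0)).
    by rewrite (big_morph _ ImD (erefl : complex.Im 0 = 0)).
  elim/big_rec2: _ => [|i x y _ ->]; first by rewrite sqrtr1.
  by rewrite sqrtrM// addr_ge0 ?sqr_ge0.
apply: le_trans (ler_norm _) _; rewrite -sqrtr_sqr ler_wsqrtr//.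
by rewrite /sqn lerDl sqr_ge0.
Qed.

End product_bound.

(** * Weighted AM-GM from Jensen's inequality for exp *)

Lemma expR_convex_sum (R : realType) (I : finType) (al t : I -> R) :
  (forall i, 0 <= al i) -> \sum_i al i = 1 ->
  expR (\sum_i al i * t i) <= \sum_i al i * expR (t i).
Proof.
move=> al0 al1; set M := \sum_i al i * t i.
have h i : al i * (expR M * (1 + (t i - M))) <= al i * expR (t i).
  rewrite ler_wpM2l// -[in leRHS](subrKC M (t i)) expRD.
  by rewrite ler_wpM2l ?expR_ge0// expR_ge1Dx.
apply: le_trans (ler_sum _ (fun i _ => h i)).
rewrite (eq_bigr (fun i => expR M * (1 - M) * al i + expR M * (al i * t i))).
  by rewrite big_split/= -!mulr_sumr al1 -/M le_eqVlt; apply/orP; left; apply/eqP; ring.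
by move=> i _; ring.
Qed.

(** The exponent condition is restricted to [u i != 1] to admit sides with l_i = 1: their weight is
    0, so no exponent satisfies it, but their factor is 1. *)
Lemma prod_sqrt_le (R : realType) (I : finType) (al u P : I -> R) :
  (forall i, 0 <= al i) -> \sum_i al i = 1 -> (forall i, 0 <= u i) ->
  (forall i, u i != 1 -> al i * P i = 2^-1) ->
  \prod_i Num.sqrt (u i) <= \sum_i al i * u i `^ P i.
Proof.
move=> al0 al1 u0 alP.
have [/existsP[i /eqP ui]|/existsPn un0] := boolP [exists i, u i == 0].
  rewrite (bigD1 i)//= ui sqrtr0 mul0r sumr_ge0// => j _.
  by rewrite mulr_ge0 ?powR_ge0.
have ugt0 i : 0 < u i by rewrite lt_def un0 u0.
have uE i : u i `^ P i = expR (P i * ln (u i)) by rewrite /powR gt_eqF.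
rewrite [leRHS](eq_bigr (fun i => al i * expR (P i * ln (u i)))); last first.
  by move=> i _; rewrite uE.
apply: le_trans (expR_convex_sum _ al0 al1).
rewrite expR_sum ler_prod// => i _; rewrite sqrtr_ge0/=.
have [->|ui] := eqVneq (u i) 1; first by rewrite sqrtr1 ln1 !mulr0 expR0.
by rewrite mulrA alP// -powR12_sqrt ?u0// /powR gt_eqF.
Qed.

(** * The count of lattice points as a trigonometric average *)

Section counting_bound.
Context (n : nat) (k l : 'I_n -> int) (m : int).
Hypothesis l1 : forall i, 1 <= l i.

Let L i := `|l i|%N.
(** A single ordinal type hosts all coordinates, and [Q] cuts it down to [L i] values. The sum also
    bounds every total of an f in the family, hence the frequencies to be averaged. *)
Let W := (\sum_i L i)%N.
Let m' := m - \sum_i k i.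
Let Q (i : 'I_n) : pred 'I_W.+1 := fun j => (j < L i)%N.
Let S : {set {ffun 'I_n -> 'I_W.+1}} :=
  [set f : {ffun 'I_n -> 'I_W.+1} |
     (f \in family Q) && (\sum_i (f i)%:Z == m')]%SET.

Let LE i : (L i)%:Z = l i. Proof. by rewrite /L; have := l1 i; lia. Qed.

Let LW i : (L i <= W)%N. Proof. by rewrite /W (bigD1 i)//= leq_addr. Qed.

Let counting_le_card (R : realType) :
  (@counting _ R [set z | box k l z /\ (\sum_(i < n) z i)%R = m]
   <= (#|S|%:R : R)%:E)%E.
Proof.
pose g (f : {ffun 'I_n -> 'I_W.+1}) : {ffun 'I_n -> int} :=
  [ffun i => k i + (f i)%:Z].
pose X := [fset g f | f in S]%fset.
have AX : [set z | box k l z /\ (\sum_(i < n) z i)%R = m] `<=` [set` X].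
  move=> z [bz zm] /=; apply/imfsetP => /=.
  have zk i : k i <= z i < k i + l i.
    by have := bz i; rewrite in_itv/=; lia.
  have fP i : (`|z i - k i|%N < W.+1)%N.
    by have := zk i; have := LE i; have := LW i; lia.
  exists [ffun i => Ordinal (fP i)]; last first.
    by apply/ffunP => i; rewrite !ffunE/=; have := zk i; lia.
  rewrite inE; apply/andP; split.
    by apply/familyP => i; rewrite ffunE unfold_in/=; have := zk i; have := LE i; lia.
  rewrite /m' -zm -sumrB; apply/eqP/eq_bigr => i _.
  by rewrite ffunE/=; have := zk i; lia.
have finA := sub_finite_set AX (finite_fset X).
rewrite /counting asboolT// lee_fin ler_nat.
apply: (@leq_trans #|` X|%N).
  by apply: fsubset_leq_card; rewrite -[X]set_fsetK -fset_set_sub.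
by apply: leq_trans (leq_imfset_card _ _ _) _; rewrite cardE.
Qed.

Let fejer_prod_le (R : realType) (x : R) :
  \sum_(f in family Q) cosz (\sum_i (f i)%:Z - m') x <=
  \prod_i Num.sqrt (fejer (L i) x).
Proof.
have := sum_cos_family Q (fun j : 'I_W.+1 => j%:R * (x *+ 2)) (- m'%:~R * (x *+ 2)).
have -> : \prod_i Num.sqrt (fejer (L i) x) =
  \prod_i Num.sqrt ((\sum_(j | Q i j) cos (j%:R * (x *+ 2))) ^+ 2
                    + (\sum_(j | Q i j) sin (j%:R * (x *+ 2))) ^+ 2).
  apply: eq_bigr => i _; rewrite fejerE.
  have LiW : (L i <= W.+1)%N by exact: leqW.
  rewrite (big_ord_widen _ (fun j => cos (j%:R * (x *+ 2))) LiW).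
  by rewrite (big_ord_widen _ (fun j => sin (j%:R * (x *+ 2))) LiW).
apply: le_trans; rewrite le_eqVlt; apply/orP; left; apply/eqP.
apply: eq_bigr => f _; rewrite /cosz; congr cos.
by rewrite -mulr_suml rmorphB/= rmorph_sum/= -mulrDl addrC.
Qed.

Let card_le_avg (R : realType) (N : nat) : (W + `|m'| < N)%N ->
  #|S|%:R <= avg (fun r : 'I_N => \prod_i Num.sqrt (fejer (L i) (grid R r))).
Proof.
move=> WN; apply: le_trans (le_avg (fun r => fejer_prod_le (grid R r))).
rewrite avg_sum (eq_bigr (fun f : {ffun 'I_n -> 'I_W.+1} =>
    (\sum_i (f i)%:Z == m')%:R)).
  rewrite -natr_sum -big_mkcondr sum1_card ler_nat.
  by apply/eq_leq/eq_card => f; rewrite !inE.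
move=> f /familyP fQ; rewrite avg_cosz ?subr_eq0//.
have : (\sum_i (f i : nat) <= W)%N.
  by apply: leq_sum => i _; have := fQ i; rewrite unfold_in => /ltnW.
have -> : \sum_i (f i)%:Z = (\sum_i (f i : nat))%N%:Z.
  by rewrite (big_morph Posz PoszD (erefl (Posz 0))).
move: (\sum_i _)%N => w; lia.
Qed.

(** Overwriting coordinate i by 0 is injective on [S], since the fixed total recovers it. *)
Let card_le_prod (i : 'I_n) : (#|S| * L i <= \prod_j L j)%N.
Proof.
pose Q' (j : 'I_n) : pred 'I_W.+1 := fun j0 => if j == i then j0 == ord0 else Q j j0.
pose h (f : {ffun 'I_n -> 'I_W.+1}) : {ffun 'I_n -> 'I_W.+1} :=
  [ffun j => if j == i then ord0 else f j].
have hinj : {in S &, injective h}.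
  move=> f g; rewrite !inE => /andP[_ /eqP fm] /andP[_ /eqP gm] fg.
  have fgj j : j != i -> f j = g j.
    move=> ji; have := congr1 (fun e : {ffun _ -> _} => e j) fg.
    by rewrite !ffunE (negbTE ji).
  apply/ffunP => j; have [->|] := eqVneq j i; last exact: fgj.
  apply/val_inj/eqP; rewrite /= -eqz_nat; move: fm; rewrite -gm.
  rewrite (bigD1 i)//= [in RHS](bigD1 i)//=.
  by rewrite (eq_bigr (fun j => (g j)%:Z)) => [/addIr->//|j' /fgj ->].
have cQ (q : 'I_n -> pred 'I_W.+1) : #|family q| = (\prod_j #|q j|)%N.
  rewrite -sum1_card (eq_bigr (fun f : {ffun 'I_n -> 'I_W.+1} => \prod_(j < n) 1)%N).
    rewrite -(bigA_distr_big_dep (fun j => q j) (fun _ _ => 1%N)).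
    by apply: eq_bigr => j _; rewrite sum1_card.
  by move=> f _; rewrite big1.
have : (#|S| <= #|family Q'|)%N.
  rewrite -(card_in_imset hinj); apply/subset_leq_card/fintype.subsetP => e.
  case/imsetP => f; rewrite inE => /andP[/familyP fQ _] ->.
  apply/familyP => j; rewrite ffunE unfold_in /Q'.
  by have := fQ j; rewrite unfold_in; case: (j == i).
rewrite cQ (bigD1 i)//=.
have -> : #|Q' i| = 1%N.
  by rewrite -(card1 (ord0 : 'I_W.+1)); apply: eq_card => j; rewrite !unfold_in /Q' eqxx.
rewrite mul1n => SQ.
rewrite (bigD1 i)//= mulnC leq_mul2l; apply/orP; right; apply: leq_trans SQ _.
apply: leq_prod => j ji.
have LjW : (L j <= W.+1)%N by exact: leqW.
rewrite -[leqRHS]card_ord -[leqRHS]sum1_card (big_ord_widen _ (fun=> 1%N) LjW).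
rewrite -sum1_card; apply/eq_leq/eq_bigl => j0.
by rewrite unfold_in /Q' (negbTE ji).
Qed.

Lemma counting_box_bounds (R : realType) : exists c : nat,
  [/\ (@counting _ R [set z | box k l z /\ (\sum_(i < n) z i)%R = m]
        <= (c%:R)%:E)%E,
      forall N, (\sum_i `|l i| + `|(m - \sum_i k i)%R| < N)%N ->
        c%:R <= avg (fun r : 'I_N =>
                       \prod_i Num.sqrt (fejer `|l i| (grid R r))) &
      forall i, (c * `|l i| <= \prod_j `|l j|)%N].
Proof.
by exists #|S|; split; [exact: counting_le_card|exact: card_le_avg|exact: card_le_prod].
Qed.

End counting_bound.

Lemma avg_prod_sqrt_lt (R : realType) (I : finType) (L : I -> nat) (N : nat)
    (S : R) :
  (forall i, (0 < L i)%N) -> S = \sum_i ((L i)%:R ^+ 2 - 1) -> 0 < S ->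
  (forall i, (L i)%:R ^+ 2 - 1 <= S / 2) ->
  (forall i, (L i + L i + L i <= N)%N) -> S / 6 + 1 < N%:R ->
  avg (fun r : 'I_N => \prod_i Num.sqrt (fejer (L i) (grid R r) / (L i)%:R ^+ 2))
  < (Num.sqrt (S / 2))^-1.
Proof.
move=> L0 SE S0 LS LN SN; pose s i : R := (L i)%:R ^+ 2 - 1.
have L1 i : 1 <= (L i)%:R :> R by rewrite ler1n.
have s0 i : 0 <= s i by rewrite subr_ge0 exprn_ege1.
pose al i := s i / S; pose P i := S / (2 * s i).
have al0 i : 0 <= al i by rewrite divr_ge0// ltW.
have al1 : \sum_i al i = 1 by rewrite -mulr_suml -SE divff// gt_eqF.
pose u i (r : 'I_N) := fejer (L i) (grid R r) / (L i)%:R ^+ 2.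
have u0 i r : 0 <= u i r by rewrite divr_ge0 ?fejer_ge0 ?sqr_ge0.
have sP i : s i != 0 -> (2 <= L i)%N.
  apply: contraNT; rewrite -ltnNge ltnS => Li.
  have Li1 : L i = 1%N by apply/eqP; rewrite eqn_leq Li L0.
  by rewrite /s Li1 expr1n subrr.
have sposP i : s i != 0 -> 0 < s i by move=> si; rewrite lt_def si s0.
have avgP i : s i != 0 -> avg (fun r => u i r `^ P i) < (Num.sqrt (S / 2))^-1.
  move=> si; have sp := sposP i si.
  have PsE : P i * s i = S / 2 by rewrite /P; field.
  have := @avg_powR_lt R N (L i) (P i) (sP i si) _ (LN i) _.
  rewrite -/(s i) PsE; apply.
    by rewrite /P ler_pdivlMr ?mulr_gt0//; have := LS i; rewrite -/(s i); lra.
  by move: SN; lra.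
have le1 : avg (fun r => \prod_i Num.sqrt (u i r))
           <= \sum_i al i * avg (fun r => u i r `^ P i).
  rewrite (eq_bigr _ (fun i _ => esym (avgZ _ _))) -avg_sum.
  apply: le_avg => r; apply: prod_sqrt_le => // i ui.
  have si : s i != 0.
    apply: contraNneq ui => si; have := L0 i; rewrite leq_eqVlt => /predU1P[Li|Li].
      by rewrite /u -Li fejer1 expr1n divr1.
    have : 2 <= (L i)%:R :> R by rewrite (ler_nat R 2).
    by move: si; rewrite /s; nra.
  by rewrite /al /P; field; rewrite si gt_eqF.
apply: le_lt_trans le1 _; move: (Num.sqrt _)^-1 avgP => B avgP.
rewrite -subr_gt0 -[X in X - _]mul1r -al1 mulr_suml -sumrB.
(* One coordinate of positive weight supplies the strict inequality; where [s i = 0] the weight is 0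
   and [P i] has the default value 0. *)
have [i si] : exists i, s i != 0.
  apply/existsP; apply: contraTT S0 => /existsPn s00.
  by rewrite SE big1 ?ltxx// => i _; apply/eqP/negbNE/s00.
rewrite (bigD1 i)//= ltr_pwDl//.
  rewrite -mulrBr; apply: mulr_gt0; last by rewrite subr_gt0 avgP.
  by apply: divr_gt0 => //; exact: sposP.
apply: sumr_ge0 => j _; rewrite -mulrBr.
have [sj|sj] := eqVneq (s j) 0; first by rewrite /al sj !mul0r.
by rewrite mulr_ge0// subr_ge0 ltW// avgP.
Qed.

(* If some l_i^2 - 1 exceeds half of the sum, the other coordinates determine
   z_i and the crude bound prod_(j != i) l_j is enough *)
Theorem corollary3p6 (R : realType) (n : nat) (hn : (1 <= n)%N)
    (k l : 'I_n -> int) (hl : forall i, 1 <= l i) (m : int) :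
  (@counting _ R [set z | box k l z /\ (\sum_(i < n) z i)%R = m]
     < if [forall j, l j == 1%R] then +oo
       else (Num.sqrt (2 : R) * ((\prod_(i < n) l i)%:~R
               / Num.sqrt (\sum_(j < n) (l j ^+ 2 - 1))%:~R))%:E)%E.
Proof.
have [c [cle cavg cprod]] := counting_box_bounds k m hl R.
apply: le_lt_trans cle _.
case: ifPn => [_|/forallPn[i0 li0]]; first exact: ltry.
rewrite lte_fin; pose L i := `|l i|%N.
have LE i : (l i)%:~R = (L i)%:R :> R.
  by rewrite pmulrn /L; congr (_%:~R); have := hl i; lia.
have L0 i : (0 < L i)%N by rewrite /L; have := hl i; lia.
pose S : R := \sum_i ((L i)%:R ^+ 2 - 1); pose p : R := \prod_i (L i)%:R.
have -> : (\prod_(i < n) l i)%:~R = p.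
  by rewrite rmorph_prod; apply: eq_bigr => i _; exact: LE.
have -> : (\sum_(j < n) (l j ^+ 2 - 1))%:~R = S.
  rewrite rmorph_sum; apply: eq_bigr => i _.
  by rewrite rmorphB/= rmorphXn/= LE.
have p0 : 0 < p by apply: prodr_gt0 => i _; rewrite ltr0n.
have s0 i : 0 <= (L i)%:R ^+ 2 - 1 :> R by rewrite subr_ge0 exprn_ege1// ler1n.
have S0 : 0 < S.
  rewrite /S (bigD1 i0)//= ltr_pwDl// ?sumr_ge0//.
  have : 2 <= (L i0)%:R :> R.
    by rewrite (ler_nat R 2) /L; have := hl i0; move: li0; lia.
  by nra.
have sqE : Num.sqrt 2 / Num.sqrt S = (Num.sqrt (S / 2))^-1.
  rewrite sqrtrM ?ltW// sqrtrV// invfM invrK mulrC//.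
rewrite mulrCA sqE.
have [/existsP[i Si]|/existsPn LS] :=
  boolP [exists i, S / 2 < (L i)%:R ^+ 2 - 1].
  have Li0 : 0 < (L i)%:R :> R by rewrite ltr0n.
  apply: (@le_lt_trans _ _ (p / (L i)%:R)).
    rewrite ler_pdivlMr// -natrM /p -natr_prod ler_nat; exact: cprod.
  rewrite ltr_pM2l// ltf_pV2 ?posrE ?sqrtr_gt0 ?divr_gt0//.
  rewrite -(ltr_pXn2r (n := 2))// ?nnegrE ?sqrtr_ge0 ?ltW// sqr_sqrtr; lra.
(* The frequencies need N > sum_i L i + |m'| with m' = m - sum_i k i; the other summands ensure 3 L
   i <= N and S / 6 + 1 < N. *)
pose N := (\sum_i L i + `|(m - \sum_i k i)%R| + 3 * \sum_i L i ^ 2 + 2)%N.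
have SN : S <= (\sum_i L i ^ 2)%N%:R.
  by rewrite natr_sum ler_sum// => i _; rewrite natrX; lra.
have := cavg N; set F := avg _ => cN.
have {cN} : c%:R <= F by apply: cN; rewrite /N -addnA -[ltnLHS]addn0 ltn_add2l addn2.
have -> : F = p * avg (fun r : 'I_N =>
    \prod_i Num.sqrt (fejer (L i) (grid R r) / (L i)%:R ^+ 2)).
  rewrite -avgZ; apply: eq_avg => r; rewrite -big_split/=.
  apply: eq_bigr => i _; have Li0 : 0 < (L i)%:R :> R by rewrite ltr0n.
  rewrite sqrtrM ?fejer_ge0// sqrtrV ?sqr_ge0// sqrtr_sqr gtr0_norm//.
  by rewrite mulrC divfK// gt_eqF.
move=> /le_lt_trans; apply; rewrite ltr_pM2l//.
apply: avg_prod_sqrt_lt => // [i|i|].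
- by rewrite leNgt; exact: LS.
- have : (L i <= \sum_i L i ^ 2)%N.
    rewrite (bigD1 i)//=; apply: (@leq_trans (L i ^ 2)); last exact: leq_addr.
    by rewrite -[leqLHS]expn1 leq_pexp2l.
  by rewrite /N; lia.
have : (\sum_i L i ^ 2 + 2 <= N)%N by rewrite /N leq_add2r; lia.
by rewrite -(ler_nat R) natrD; lra.
Qed.
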